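(* Let $C$ and $N$ be real-valued random variables having a bounded joint probability density $p_{N,C}$ with respect to Lebesgue measure, with $\mathbb{E}[N\mid C=c]=0$, let $\phi$ be a function, and for $\alpha>0$ set $E_\alpha := \phi(C)+\alpha N$. Assume: (1) $\phi:[0,1]\to[0,1]$ is strictly monotonically increasing and two times differentiable, $\phi(0)=0$, $\phi(1)=1$, and the derivative $(\phi^{-1})'$ of the inverse function is bounded. (2) The distribution of $C$ has compact support, and $0$ and $1$ are, respectively, the smallest and the largest values attained by $C$. The distribution of $N$ has compact support, and there exist $n_+>0>n_-$ such that for any $c\in[0,1]$, $[n_-,n_+]$ is the smallest interval containing the support of the conditional density $p_{N|c}$. (3) $\mathbb{E}[\operatorname{Var}[N\mid C]]=1$. (4) $\displaystyle \int_0^1 \phi'(c)\operatorname{Var}[N\mid c]\,p_C(c)\,dc-\int_0^1\phi'(c)\,dc\int_0^1\operatorname{Var}[N\mid c]\,p_C(c)\,dc=0.$ Define the rescaled variable $$\tilde E_\alpha := \frac{1}{1+\alpha n_+-\alpha n_-}\,(E_\alpha-\alpha n_-).$$ Then the following limit exists and satisfies $$\lim_{\alpha\to 0}\frac{\mathbb{E}[\operatorname{Var}[C\mid\tilde E_\alpha]]}{\mathbb{E}[\operatorname{Var}[\tilde E_\alpha\mid C]]}\ \ge\ 1,$$ with equality only if $\phi$ is linear.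
   Context: $p_C$ denotes the marginal density of $C$ (with respect to Lebesgue measure), and $p_{N|c}$ the conditional density of $N$ given $C=c$. For random variables $Z,Q$, the conditional variance is $\operatorname{Var}[Z\mid q]:=\mathbb{E}[(Z-\mathbb{E}[Z\mid q])^2\mid q]$ (conditioning on $Q=q$); $\operatorname{Var}[Z\mid Q]$ is the random variable taking the value $\operatorname{Var}[Z\mid q]$ when $Q=q$, so $\mathbb{E}[\operatorname{Var}[Z\mid Q]]=\int \operatorname{Var}[Z\mid q]\,p_Q(q)\,dq$. The parameter $\alpha$ ranges over positive reals. $C$ is the cause, and $E=E_1=\phi(C)+N$ is the effect, with $\phi(c)=\mathbb{E}[E\mid C=c]$, i.e. $N=E-\phi(C)$ and $\mathbb{E}[N\mid c]=0$. The noise $N$ is not assumed to be statistically independent of $C$. Condition (4) says that $c\mapsto\phi'(c)$ and $c\mapsto \operatorname{Var}[N\mid c]\,p_C(c)$, regarded as random variables on $[0,1]$ with the uniform probability measure, are uncorrelated. *)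

(* Defs.v *)
From HB Require Import structures.
From mathcomp Require Import all_boot all_order all_algebra.
From mathcomp Require Import all_classical all_reals all_analysis.

Set Implicit Arguments.
Unset Strict Implicit.
Unset Printing Implicit Defensive.

Import Order.TTheory GRing.Theory Num.Theory.
Import numFieldNormedType.Exports.

Local Open Scope classical_set_scope.
Local Open Scope ring_scope.

(* Derivatives of functions that are only meaningful on a set A: the increment
   stays in A, so they are one-sided at the endpoints of a closed interval. *)
Definition diff_quotient (R : realType) (f : R -> R) (x y : R) : R :=
  (f y - f x) / (y - x).

Definition derivable_on (R : realType) (A : set R) (f : R -> R) (x : R) : Prop :=
  cvg (diff_quotient f x y @[y --> within A x^']).

Definition derive_on (R : realType) (A : set R) (f : R -> R) (x : R) : R :=
  lim (diff_quotient f x y @[y --> within A x^']).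

Definition law_support (d : measure_display) (T : measurableType d)
    (R : realType) (P : probability T R) (X : T -> R) : set R :=
  [set x | forall e : R, 0 < e -> (0 < P (X @^-1` ball x e))%E].

Definition smallest_itv_containing (R : realType) (S : set R) (a b : R) : Prop :=
  S `<=` `[a, b] /\
  forall J : set R, is_interval J -> S `<=` J -> `[a, b] `<=` J.

Definition is_joint_density (d : measure_display) (T : measurableType d)
    (R : realType) (P : probability T R) (X Y : T -> R) (p : R * R -> R) : Prop :=
  [/\ measurable_fun setT p,
      forall z, 0 <= p z
    & forall A : set (R * R), measurable A ->
        P ((fun w => (X w, Y w)) @^-1` A) =
        (\int[lebesgue_measure \x lebesgue_measure]_(z in A) (p z)%:E)%E].

Definition marginal_density (R : realType) (p : R * R -> R) (c : R) : R :=
  \int[lebesgue_measure]_n p (n, c).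

(* Identically zero, hence with empty support, where the marginal vanishes. *)
Definition cond_density (R : realType) (p : R * R -> R) (c n : R) : R :=
  p (n, c) / marginal_density p c.

(* g is a version of the map q |-> E[Z | Q = q]. *)
Definition is_cond_exp (d : measure_display) (T : measurableType d)
    (R : realType) (P : probability T R) (Z Q : T -> R) (g : R -> R) : Prop :=
  [/\ measurable_fun setT g,
      P.-integrable setT (EFin \o (g \o Q))
    & forall B : set R, measurable B ->
        (\int[P]_(w in Q @^-1` B) (g (Q w))%:E =
         \int[P]_(w in Q @^-1` B) (Z w)%:E)%E].

(* A chosen version, unique up to null sets of the law of Q; one exists when Z
   is integrable and Q measurable, and 0 is a dummy value otherwise. *)
Definition cond_exp (d : measure_display) (T : measurableType d)
    (R : realType) (P : probability T R) (Z Q : T -> R) : R -> R :=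
  xget (cst 0) [set g | is_cond_exp P Z Q g].

(* Given Q = q, the random variable Z - E[Z | q] is Z - E[Z | Q]. *)
Definition cond_var (d : measure_display) (T : measurableType d)
    (R : realType) (P : probability T R) (Z Q : T -> R) : R -> R :=
  cond_exp P (fun w => (Z w - cond_exp P Z Q (Q w)) ^+ 2) Q.

Definition mean_cond_var (d : measure_display) (T : measurableType d)
    (R : realType) (P : probability T R) (Z Q : T -> R) : \bar R :=
  expectation P (cond_var P Z Q \o Q).

(* phi is a function on [0, 1] only; C lies there almost surely, so the value 0
   given to phi elsewhere is immaterial. *)
Definition effect (T : Type) (R : realType) (phi : R -> R) (C N : T -> R)
    (alpha : R) (w : T) : R :=
  (phi \_ `[0, 1]) (C w) + alpha * N w.

Definition rescaled_effect (T : Type) (R : realType) (phi : R -> R)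
    (C N : T -> R) (nm np alpha : R) (w : T) : R :=
  (1 + alpha * np - alpha * nm)^-1 * (effect phi C N alpha w - alpha * nm).

Definition error_ratio (d : measure_display) (T : measurableType d)
    (R : realType) (P : probability T R) (phi : R -> R) (C N : T -> R)
    (nm np alpha : R) : R :=
  let E := rescaled_effect phi C N nm np alpha in
  fine (mean_cond_var P C E) / fine (mean_cond_var P E C).

(* Main.v *)
(* Let F = phi(C) + alpha N be the effect and psi = phi^-1.  Up to o(alpha) in
   L^2, C - psi(F) equals alpha X with X = - N psi'(phi(C)).  The best predictor of
   C from F improves on psi(F) by alpha E[X | F], and this correction is
   negligible: E[X | F] -> 0, because E[N | C] = 0 and the joint law of N and
   phi(C) is absolutely continuous, so that shifting phi(C) by alpha N changes it
   little in total variation (L^1-continuity of translations).  Hence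
   E[Var[C | F]] / alpha^2 tends to E[N^2 / phi'(C)^2], while
   E[Var[F | C]] = alpha^2.  The uncorrelatedness hypothesis says
   E[N^2 phi'(C)] = 1 = E[N^2], and 1 / t^2 >= 3 - 2 t, with equality only at
   t = 1, gives the bound and forces phi' = 1 almost everywhere when the limit
   is 1. *)

Require Import Defs.
From HB Require Import structures.
From mathcomp Require Import all_boot all_order all_algebra.
From mathcomp Require Import all_classical all_reals all_analysis.
From mathcomp Require Import measurable_realfun ring lra.
Import Order.TTheory GRing.Theory Num.Theory.
Import numFieldNormedType.Exports.
Local Open Scope classical_set_scope.
Local Open Scope ring_scope.
Set Implicit Arguments.
Unset Strict Implicit.
Unset Printing Implicit Defensive.

(** * Conditional expectations *)

Section weighted_pushforward.
Local Open Scope ereal_scope.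
Context (R : realType).
Import HBNNSimple.

(** The obstacle is that [E[X | F]] is only a measurable function of the effect that changes with
    alpha and has no known regularity. What is available is a bound uniform in alpha, so vanishing
    of the correlation with X is shown for every uniformly bounded sequence of test functions of the
    effect. Translation is not continuous uniformly over such functions; a change of variables moves
    it onto a fixed integrable function. As N may depend on C, this is done for each noise value n
    separately, and the bounded joint density then allows dominated convergence in n. Conditional
    expectations enter only through orthogonality: two residuals that differ by a function of the
    conditioning variable, both orthogonal to such functions, have equal second moments. The line
    [3 - 2 t] is the tangent to the convex function [1 / t^2] at [t = 1], the mean of [phi'(C)]
    under the weight [N^2], so the bound is Jensen's inequality for that weight. *)

Lemma ge0_integral_weighted_comp d d' (X : measurableType d)
    (Y : measurableType d') (mu : {measure set X -> \bar R}) (Q : X -> Y)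
    (w : X -> R) (f : Y -> \bar R) (mf : measurable_fun [set: Y] f) :
  measurable_fun setT Q -> measurable_fun setT w -> (forall x, 0 <= w x)%R ->
  (forall y, 0 <= f y) ->
  \int[mu]_x (f (Q x) * (w x)%:E) =
  limn (fun n => \sum_(y \in range (nnsfun_approx measurableT mf n))
     (y%:E * \int[mu]_(x in Q @^-1` (nnsfun_approx measurableT mf n @^-1` [set y])) (w x)%:E)).
Proof.
move=> mQ mw w0 f0; set h := nnsfun_approx measurableT mf.
have fg x : f (Q x) * (w x)%:E = limn (fun n => (h n (Q x))%:E * (w x)%:E).
  apply/esym/cvg_lim => //; apply: cvgeZr => //.
  exact: cvg_nnsfun_approx.
under eq_integral => x _ do rewrite fg.
rewrite monotone_convergence//; last 3 first.
- move=> n; apply: emeasurable_funM; apply/measurable_EFinP => //.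
  by apply: measurableT_comp.
- by move=> n x _; rewrite mule_ge0// lee_fin.
- move=> x _ a b ab; rewrite lee_wpmul2r ?lee_fin//.
  exact/lefP/nd_nnsfun_approx.
congr (limn _); apply/funext => n.
transitivity (\int[mu]_x (\sum_(y \in range (h n))
    (y * \1_(h n @^-1` [set y]) (Q x))%:E * (w x)%:E)).
  apply: eq_integral => x _.
  rewrite -ge0_mule_fsuml => [|y]; last exact: nnfun_muleindic_ge0.
  by rewrite fsumEFin // -(fimfunE _ (Q x)).
have mI y : measurable_fun setT (fun x => (\1_(h n @^-1` [set y]) (Q x))%:E : \bar R).
  by apply/measurable_EFinP; apply: measurableT_comp.
rewrite ge0_integral_fsum//; last 2 first.
- move=> y; under eq_fun do rewrite EFinM.
  apply: emeasurable_funM; last exact/measurable_EFinP.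
  exact: emeasurable_funM.
- move=> y x _; apply: mule_ge0; last by rewrite lee_fin.
  by rewrite EFinM; exact: nnfun_muleindic_ge0.
apply: eq_fsbigr => r; rewrite inE => -[y0 _ hr].
under [LHS]eq_integral do rewrite EFinM -muleA.
have r0 : (0 <= r)%R by rewrite -hr.
rewrite ge0_integralZl//; last 2 first.
- apply: emeasurable_funM => //; exact/measurable_EFinP.
- by move=> x _; rewrite mule_ge0 ?lee_fin.
congr (_ * _); rewrite [RHS]integral_mkcond; apply: eq_integral => x _.
rewrite patchE indicE; case: ifPn => [/set_mem xr|xr].
  by rewrite mem_set// mul1e.
rewrite memNset ?mul0e// => xr'; move/negP: xr; apply; exact/mem_set.
Qed.

(** Approximation of f by simple functions shows that the integral depends on Q and w only through
    the integrals of w over preimages under Q. This principle yields the substitution [y = phi c],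
    the passage to joint and marginal densities, and the comparison of positive and negative parts
    below. *)
Lemma ge0_eq_integral_weighted_comp d1 d2 d' (X1 : measurableType d1)
    (X2 : measurableType d2) (Y : measurableType d')
    (m1 : {measure set X1 -> \bar R}) (m2 : {measure set X2 -> \bar R})
    (Q1 : X1 -> Y) (Q2 : X2 -> Y) (w1 : X1 -> R) (w2 : X2 -> R)
    (f : Y -> \bar R) :
  measurable_fun setT Q1 -> measurable_fun setT Q2 ->
  measurable_fun setT w1 -> measurable_fun setT w2 ->
  (forall x, 0 <= w1 x)%R -> (forall x, 0 <= w2 x)%R ->
  (forall B, measurable B -> \int[m1]_(x in Q1 @^-1` B) (w1 x)%:E =
                             \int[m2]_(x in Q2 @^-1` B) (w2 x)%:E) ->
  measurable_fun setT f -> (forall y, 0 <= f y) ->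
  \int[m1]_x (f (Q1 x) * (w1 x)%:E) = \int[m2]_x (f (Q2 x) * (w2 x)%:E).
Proof.
move=> mQ1 mQ2 mw1 mw2 w10 w20 w12 mf f0.
rewrite !(@ge0_integral_weighted_comp _ _ _ _ _ _ _ f mf)//.
by congr (limn _); apply/funext => n; apply: eq_fsbigr => y _; rewrite w12.
Qed.

End weighted_pushforward.

(** * Bounded measurable functions *)

Section bounded_measurable.
Context d (T : measurableType d) (R : realType).
Implicit Types f g : T -> R.

(** The class in which most of the argument takes place: it is stable under algebra and composition,
    and every finite measure integrates its members. The bound holds at every point, not almost
    everywhere. *)
Definition bounded_mfun f :=
  measurable_fun [set: T] f /\ exists K, forall x, `|f x| <= K.

Lemma bounded_mfun_cst (r : R) : bounded_mfun (fun=> r).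
Proof. by split => //; exists `|r|. Qed.

Lemma bounded_mfunD f g : bounded_mfun f -> bounded_mfun g ->
  bounded_mfun (fun x => f x + g x).
Proof.
move=> [mf [K fK]] [mg [L gL]]; split; first exact: measurable_funD.
exists (K + L) => x; exact: le_trans (ler_normD _ _) (lerD (fK x) (gL x)).
Qed.

Lemma bounded_mfunM f g : bounded_mfun f -> bounded_mfun g ->
  bounded_mfun (fun x => f x * g x).
Proof.
move=> [mf [K fK]] [mg [L gL]]; split; first exact: measurable_funM.
by exists (K * L) => x; rewrite normrM ler_pM.
Qed.

Lemma bounded_mfunB f g : bounded_mfun f -> bounded_mfun g ->
  bounded_mfun (fun x => f x - g x).
Proof.
move=> bf [mg [L gL]]; apply: bounded_mfunD => //; split.
  exact: measurableT_comp.
by exists L => x; rewrite normrN.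
Qed.

Lemma bounded_mfunX f n : bounded_mfun f -> bounded_mfun (fun x => f x ^+ n).
Proof.
move=> bf; elim: n => [|n ih].
  by under eq_fun do rewrite expr0; exact: bounded_mfun_cst.
by under eq_fun do rewrite exprS; exact: bounded_mfunM.
Qed.

Lemma bounded_integrable (mu : {finite_measure set T -> \bar R}) D f :
  measurable D -> bounded_mfun f -> mu.-integrable D (EFin \o f).
Proof.
move=> mD [mf [K fK]]; apply: measurable_bounded_integrable => //.
- by rewrite ltey_eq fin_num_measure.
- exact: measurable_funTS.
- exists K; split; first by rewrite num_real.
  by move=> y Ky x _; exact: le_trans (fK x) (ltW Ky).
Qed.

End bounded_measurable.

Lemma bounded_mfun_comp d d' (T : measurableType d) (T' : measurableType d')
    (R : realType) (f : T -> R) (Q : T' -> T) :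
  bounded_mfun f -> measurable_fun setT Q -> bounded_mfun (f \o Q).
Proof.
move=> [mf [K fK]] mQ; split; first exact: measurableT_comp.
by exists K => x; exact: fK.
Qed.

(** * Existence, orthogonality and bounded versions of conditional expectations *)

Section conditional_expectation.
Context d (T : measurableType d) (R : realType) (P : probability T R).
Implicit Types (Z Q : T -> R) (g h : R -> R).

(** The Radon-Nikodym derivative, with respect to the law of Q, of the image under Q of the signed
    measure with density Z. Working on the real line gives g directly as a function of the value of
    Q, with no factorization of a Q-measurable variable. *)
Lemma is_cond_exp_exists Z Q : measurable_fun setT Q ->
  P.-integrable setT (EFin \o Z) -> exists g, is_cond_exp P Z Q g.
Proof.
move=> mQ iZ.
pose nu0 : {charge set T -> \bar R} := induced_charge iZ.
unshelve epose (nu := pushforward nu0 Q : {charge set R -> \bar R}); first exact mQ.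
pose Qm : {mfun T >-> R} := HB.pack Q (isMeasurableFun.Build _ _ _ _ Q mQ).
pose mu : probability R R := distribution P Qm.
have numu : nu `<< mu.
  apply/null_content_dominatesP => A mA muA.
  rewrite /nu /= /pushforward /nu0/= /induced_charge.
  apply: null_set_integral => //.
    by rewrite -[X in measurable X]setTI; apply: (mQ).
  by apply: measurable_funTS; exact: measurable_int iZ.
pose f : R -> \bar R := Radon_Nikodym nu mu.
have ffin x : f x \is a fin_num by exact: Radon_Nikodym_fin_num.
have fi : mu.-integrable setT f by exact: Radon_Nikodym_integrable.
have fE : EFin \o (fine \o f) = f.
  by apply/funext => x /=; rewrite fineK.
have mf : measurable_fun setT f := measurable_int _ fi.
have iQ : P.-integrable setT (f \o Q).
  apply/integrableP; split; first exact: measurableT_comp.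
  move/integrableP : fi => [_].
  by rewrite /mu/= ge0_integral_distribution//; exact: measurableT_comp.
exists (fine \o f); split.
- by apply/measurable_EFinP; rewrite fE.
- by rewrite compA fE.
- move=> B mB.
  have mQB : measurable (Q @^-1` B) by rewrite -[X in measurable X]setTI; apply: (mQ).
  transitivity (\int[P]_(w in Q @^-1` B) ((f \o Q) w))%E.
    by apply: eq_integral => w _ /=; rewrite fineK.
  transitivity (nu B); last by [].
  rewrite (Radon_Nikodym_integral numu mB) -/f.
  by rewrite /mu /= /distribution integral_pushforward//; exact: integrableS iQ.
Qed.

Lemma cond_expP Z Q : measurable_fun setT Q ->
  P.-integrable setT (EFin \o Z) -> is_cond_exp P Z Q (cond_exp P Z Q).
Proof.
move=> mQ iZ; rewrite /cond_exp; case: xgetP => [g _ //|].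
by have [g hg] := is_cond_exp_exists mQ iZ => /(_ g).
Qed.

(** The positive and negative parts of W weight all preimages under Q equally, so they integrate
    every nonnegative bounded function of Q to the same value. *)
Lemma integral_comp_orthogonal (W : T -> R) Q h : measurable_fun setT Q ->
  P.-integrable setT (EFin \o W) -> bounded_mfun h ->
  (forall B, measurable B -> \int[P]_(w in Q @^-1` B) (W w)%:E = 0)%E ->
  \int[P]_w (h (Q w) * W w) = 0.
Proof.
move=> mQ iW bh W0.
have mW : measurable_fun setT W by case/integrableP: iW => /measurable_EFinP.
have mQB B : measurable B -> measurable (Q @^-1` B).
  by move=> mB; rewrite -[X in measurable X]setTI; apply: (mQ).
have [mh [K hK]] := bh.
have iWp : P.-integrable setT (EFin \o W^\+) by exact: integrable_funrpos.
have iWn : P.-integrable setT (EFin \o W^\-) by exact: integrable_funrneg.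
have WE w : W w = W^\+ w - W^\- w by rewrite -[in LHS](funrposBneg W).
have key (k : R -> R) : bounded_mfun k -> (forall x, 0 <= k x) ->
    \int[P]_w (k (Q w) * W w) = 0.
  move=> bk k0; have [mk [L kL]] := bk.
  have ikW (V : T -> R) : P.-integrable setT (EFin \o V) ->
      P.-integrable setT (EFin \o (fun w => k (Q w) * V w)).
    move=> iV; apply: (@integrableMr _ _ _ _ _ _ (k \o Q) (EFin \o V)) => //.
      exact: measurableT_comp.
    exists L; split; first by rewrite num_real.
    by move=> y Ky x _; exact: le_trans (kL _) (ltW Ky).
  under eq_Rintegral => w _ do rewrite WE mulrBr.
  rewrite RintegralB//; [|exact: ikW..].
  apply/eqP; rewrite subr_eq0; apply/eqP; congr fine.
  under eq_integral => w _ do rewrite EFinM.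
  under [RHS]eq_integral => w _ do rewrite EFinM.
  apply: (@ge0_eq_integral_weighted_comp R _ _ _ _ _ _ P P Q Q W^\+ W^\-
    (EFin \o k)) => //.
  - exact: measurable_funrpos.
  - exact: measurable_funrneg.
  - move=> B mB.
    have : (\int[P]_(w in Q @^-1` B) ((W^\+ w)%:E - (W^\- w)%:E) = 0)%E.
      by rewrite -(W0 B mB); apply: eq_integral => w _; rewrite WE EFinB.
    have iB (f : T -> \bar R) : P.-integrable setT f -> P.-integrable (Q @^-1` B) f.
      by move=> fi; apply: integrableS fi => //; exact: mQB.
    rewrite (integralB _ (iB _ iWp) (iB _ iWn)); last exact: mQB.
    move/eqP; rewrite sube_eq ?add0e; first by move/eqP.
      by apply: integrable_fin_num; [exact: mQB|exact: iB].
    exact: fin_num_adde_defr.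
  - exact/measurable_EFinP.
have bK := bounded_mfun_cst R K.
(* A signed h is reduced to the nonnegative case by adding its bound K. *)
under eq_Rintegral => w _ do rewrite -[h (Q w)](addrK K) mulrBl.
rewrite RintegralB//.
- rewrite (key (fun x => h x + K)).
  + rewrite (key (fun=> K)) ?subr0// => _.
    exact: le_trans (hK point).
  + exact: bounded_mfunD.
  + by move=> x; rewrite -lerBlDr sub0r; have := hK x; rewrite ler_norml => /andP[].
- apply: (@integrableMr _ _ _ _ _ _ (fun w => h (Q w) + K) (EFin \o W)) => //.
    by apply: measurable_funD => //; exact: measurableT_comp.
  exists (K + K); split; first by rewrite num_real.
  move=> y Ky x _ /=; apply: le_trans (ltW Ky).
  rewrite (le_trans (ler_normD _ _))// lerD// ger0_norm//.
  exact: le_trans (hK point).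
- by have := integrableZl measurableT K iW.
Qed.

Lemma ae_integrable Z Z' : measurable_fun setT Z' ->
  {ae P, forall w, Z w = Z' w} -> P.-integrable setT (EFin \o Z) ->
  P.-integrable setT (EFin \o Z').
Proof.
move=> mZ' ZZ' /integrableP[mZ iZ]; apply/integrableP.
have mZ'' : measurable_fun setT (EFin \o Z') by exact/measurable_EFinP.
split=> //; rewrite (ae_eq_integral (abse \o (EFin \o Z)))//.
- exact: measurableT_comp.
- exact: measurableT_comp.
- by apply: filterS ZZ' => w /= -> _.
Qed.

Lemma ae_eq_Rintegral (U V : T -> R) : measurable_fun setT U ->
  measurable_fun setT V ->
  {ae P, forall w, U w = V w} -> \int[P]_w U w = \int[P]_w V w.
Proof.
move=> mU mV UV; congr fine; apply: ae_eq_integral => //.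
- exact/measurable_EFinP.
- exact/measurable_EFinP.
- by apply: filterS UV => w /= -> _.
Qed.

Lemma is_cond_exp_ae_eq Z Z' Q g : measurable_fun setT Q ->
  measurable_fun setT Z -> measurable_fun setT Z' ->
  {ae P, forall w, Z w = Z' w} -> is_cond_exp P Z Q g -> is_cond_exp P Z' Q g.
Proof.
move=> mQ mZ mZ' ZZ' [mg ig gZ]; split => // B mB.
have mQB : measurable (Q @^-1` B) by rewrite -[X in measurable X]setTI; exact: mQ.
rewrite gZ//; apply: ae_eq_integral => //.
- by apply: measurable_funTS; exact/measurable_EFinP.
- by apply: measurable_funTS; exact/measurable_EFinP.
- by apply: filterS ZZ' => w /= -> _.
Qed.

Lemma is_cond_exp_integral Z Q g u : measurable_fun setT Q ->
  P.-integrable setT (EFin \o Z) -> is_cond_exp P Z Q g -> bounded_mfun u ->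
  \int[P]_w (u (Q w) * (Z w - g (Q w))) = 0.
Proof.
move=> mQ iZ [mg ig gZ] bu.
have iW : P.-integrable setT (EFin \o (fun w => Z w - g (Q w))).
  by have := integrableB measurableT iZ ig.
apply: integral_comp_orthogonal => // B mB.
have mQB : measurable (Q @^-1` B) by rewrite -[X in measurable X]setTI; exact: mQ.
have iB (f : T -> \bar R) : P.-integrable setT f -> P.-integrable (Q @^-1` B) f.
  by move=> fi; exact: integrableS fi.
transitivity (\int[P]_(w in Q @^-1` B) ((EFin \o Z) w - (EFin \o (g \o Q)) w))%E.
  by apply: eq_integral => w _.
rewrite integralB//; [|exact: iB|exact: iB].
by rewrite /= gZ// subee//; apply: integrable_fin_num => //; exact: iB.
Qed.

Lemma ae_eq0_Rintegral (V : T -> R) : P.-integrable setT (EFin \o V) ->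
  (forall w, 0 <= V w) -> \int[P]_w V w = 0 -> {ae P, forall w, V w = 0}.
Proof.
move=> iV V0 iV0.
have mV : measurable_fun setT (EFin \o V) := measurable_int _ iV.
have : ae_eq P setT (EFin \o V) (cst 0%E).
  apply/ae_eq_integral_abs => //.
  under eq_integral => w _ do rewrite /= ger0_norm//.
  by rewrite -[LHS]fineK ?integrable_fin_num//; congr EFin.
by apply: filterS => w h; apply: EFin_inj; exact: h I.
Qed.

Lemma is_cond_exp_ae_bounded Z Q g K : measurable_fun setT Q ->
  measurable_fun setT Z -> (forall w, `|Z w| <= K) ->
  is_cond_exp P Z Q g -> {ae P, forall w, `|g (Q w)| <= K}.
Proof.
move=> mQ mZ ZK gZ; have [mg ig _] := gZ.
have iZ : P.-integrable setT (EFin \o Z).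
  by apply: bounded_integrable => //; split => //; exists K.
have iW : P.-integrable setT (EFin \o (fun w => Z w - g (Q w))).
  by have := integrableB measurableT iZ ig.
(* The sign that makes [u (Q w) * (Z w - g (Q w))] strictly positive wherever [g (Q w)] leaves
   [[- K, K]]. This product is nonnegative with integral zero, so it vanishes almost surely. *)
pose u x : R := if K < g x then -1 else if g x < - K then 1 else 0.
have bu : bounded_mfun u.
  split; last first.
    exists 1 => x; rewrite /u; case: ifP => _; [|case: ifP => _];
      by rewrite ?normrN1 ?normr1 ?normr0.
  apply: measurable_fun_ifT => //; first exact: measurable_fun_ltr.
  by apply: measurable_fun_ifT => //; exact: measurable_fun_ltr.
have Zg w : (Z w <= K) /\ (- K <= Z w) by have := ZK w; rewrite ler_norml => /andP[].
pose V w := u (Q w) * (Z w - g (Q w)).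
have : {ae P, forall w, V w = 0}.
  apply: ae_eq0_Rintegral; last exact: is_cond_exp_integral.
  - apply: (@integrableMr _ _ _ _ _ _ (u \o Q) (EFin \o (fun w => Z w - g (Q w)))) => //.
      by apply: measurableT_comp => //; exact: bu.1.
    have [L uL] := bu.2; exists L; split; first by rewrite num_real.
    by move=> y Ly x _; exact: le_trans (uL _) (ltW Ly).
  - move=> w; rewrite /V /u; have [h1 h2] := Zg w.
    case: ifPn => [Kg|_]; first by lra.
    by case: ifPn => [Kg|_]; [lra|rewrite mul0r].
apply: filterS => w; rewrite /V /u; have [h1 h2] := Zg w.
rewrite ler_norml; case: ifPn => [Kg|]; first by lra.
rewrite -leNgt => gK; case: ifPn => [Kg|]; first by lra.
by rewrite -leNgt => Kg _; rewrite Kg.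
Qed.

(* All conditional expectations and variances of [Z] given [Q] can be computed
   with the bounded representatives [Z'] and [h]. *)
Lemma mean_cond_var_bounded Z Z' Q K : measurable_fun setT Q ->
  measurable_fun setT Z -> measurable_fun setT Z' ->
  (forall w, `|Z' w| <= K) -> {ae P, forall w, Z w = Z' w} ->
  exists h : R -> R, [/\ measurable_fun setT h /\ forall x, `|h x| <= K,
    {ae P, forall w, cond_exp P Z Q (Q w) = h (Q w)},
    forall u, bounded_mfun u -> \int[P]_w (u (Q w) * (Z' w - h (Q w))) = 0,
    is_cond_exp P (fun w => (Z' w - h (Q w)) ^+ 2) Q (cond_var P Z Q) &
    mean_cond_var P Z Q = (\int[P]_w (Z' w - h (Q w)) ^+ 2)%:E].
Proof.
move=> mQ mZ mZ' Z'K ZZ'.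
have K0 : 0 <= K := le_trans (normr_ge0 _) (Z'K point).
have iZ' : P.-integrable setT (EFin \o Z').
  by apply: bounded_integrable => //; split => //; exists K.
have iZ : P.-integrable setT (EFin \o Z).
  by apply: ae_integrable iZ' => //; apply: filterS ZZ' => w ->.
have gZ := cond_expP mQ iZ; set g := cond_exp P Z Q in gZ *.
have gZ' : is_cond_exp P Z' Q g by exact: is_cond_exp_ae_eq gZ.
have gK := is_cond_exp_ae_bounded mQ mZ' Z'K gZ'.
have [mg ig _] := gZ.
(* Truncation at K changes [g (Q w)] only on a null set and makes the bound hold at every point, so
   that h may enter bounded test functions. *)
pose h x := Num.max (- K) (Num.min K (g x)).
have mh : measurable_fun setT h.
  by apply: measurable_maxr => //; exact: measurable_minr.
have hK x : `|h x| <= K.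
  rewrite ler_norml /h le_max lexx/= ge_max ge_min lexx/= andbT; lra.
have gh : {ae P, forall w, g (Q w) = h (Q w)}.
  apply: filterS gK => w; rewrite ler_norml => /andP[g1 g2].
  by rewrite /h (min_idPr g2) (max_idPr g1).
have mhQ : measurable_fun setT (h \o Q) by exact: measurableT_comp.
have mgQ : measurable_fun setT (g \o Q) by exact: measurableT_comp.
have bV : bounded_mfun (fun w => (Z' w - h (Q w)) ^+ 2).
  apply: bounded_mfunX; apply: bounded_mfunB; first by split => //; exists K.
  by split => //; exists K => w; exact: hK.
have iV : P.-integrable setT (EFin \o (fun w => (Z' w - h (Q w)) ^+ 2)).
  exact: bounded_integrable.
have mV : measurable_fun setT (fun w => (Z w - g (Q w)) ^+ 2).
  by apply: measurable_funX; exact: measurable_funB.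
have VV : {ae P, forall w, (Z w - g (Q w)) ^+ 2 = (Z' w - h (Q w)) ^+ 2}.
  by apply: filterS2 ZZ' gh => w -> ->.
have iV' : P.-integrable setT (EFin \o (fun w => (Z w - g (Q w)) ^+ 2)).
  by apply: ae_integrable iV => //; apply: filterS VV => w ->.
have cV : is_cond_exp P (fun w => (Z' w - h (Q w)) ^+ 2) Q (cond_var P Z Q).
  apply: is_cond_exp_ae_eq (cond_expP mQ iV') => //; exact: bV.1.
exists h; split => //.
- move=> u bu; rewrite -[RHS](is_cond_exp_integral mQ iZ' gZ' bu).
  have muQ : measurable_fun setT (u \o Q) by apply: measurableT_comp => //; exact: bu.1.
  apply: ae_eq_Rintegral.
  + by apply: measurable_funM => //; exact: measurable_funB.
  + by apply: measurable_funM => //; exact: measurable_funB.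
  + by apply: filterS gh => w ->.
- have [_ _ /(_ setT measurableT)] := cV.
  rewrite preimage_setT /mean_cond_var unlock => /= ->.
  by rewrite /Rintegral fineK//; exact: integrable_fin_num.
Qed.

End conditional_expectation.

(** * Translations in L^1 *)

Lemma Rdominated_convergence d (T : measurableType d) (R : realType)
    (mu : {measure set T -> \bar R}) (D : set T) (f_ : nat -> T -> R)
    (f g : T -> R) :
  measurable D -> (forall n, measurable_fun D (f_ n)) -> measurable_fun D f ->
  {ae mu, forall x, D x -> f_ n x @[n --> \oo] --> f x} ->
  mu.-integrable D (EFin \o g) ->
  {ae mu, forall x, forall n, D x -> `|f_ n x| <= g x} ->
  \int[mu]_(x in D) f_ n x @[n --> \oo] --> \int[mu]_(x in D) f x.
Proof.
move=> mD mf_ mf f_f ig f_g.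
have mF n : measurable_fun D (EFin \o f_ n) by exact/measurable_EFinP.
have mF' : measurable_fun D (EFin \o f) by exact/measurable_EFinP.
have F_F : {ae mu, forall x, D x ->
    (EFin \o f_ n) x @[n --> \oo] --> (EFin \o f) x}.
  apply: filterS f_f => x fx Dx; apply: cvg_EFin; last exact: fx.
  exact: nearW.
have F_g : {ae mu, forall x, forall n, D x ->
    (`|(EFin \o f_ n) x| <= (EFin \o g) x)%E}.
  by apply: filterS f_g => x fg n Dx; rewrite lee_fin; exact: fg.
have [ifi _ cf] := dominated_convergence mD mF mF' F_F ig F_g.
by apply: fine_cvg; rewrite fineK//; exact: integrable_fin_num.
Qed.

Section translation.
Context (R : realType).
Notation mu := (@lebesgue_measure R).
Implicit Types (f g h : R -> R).

Lemma lebesgue_measure_shift (s : R) (A : set R) : measurable A ->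
  pushforward mu (fun x => x + s : measurableTypeR R) A = mu A.
Proof.
have ms : measurable_fun [set: measurableTypeR R] (fun x : R => x + s : measurableTypeR R).
  exact: measurable_funD.
move=> mA; apply/esym; unshelve apply: lebesgue_measure_unique => //=.
move=> _ [[a b]] _ <-.
rewrite /pushforward/=.
have -> : (fun x : R => x + s) @^-1` `]a, b]%classic = `]a - s, b - s]%classic.
  by apply/seteqP; split => x /=; rewrite !in_itv/=; lra.
rewrite !lebesgue_measure_itv/= !lte_fin ltrD2r.
by case: ifP => // _; congr EFin; lra.
Qed.

Lemma integrable_bounded_support f (a b K : R) : measurable_fun setT f ->
  (forall x, `|f x| <= K) -> (forall x, ~ `[a, b]%classic x -> f x = 0) ->
  mu.-integrable setT (EFin \o f).
Proof.
move=> mf fK f0.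
have -> : EFin \o f = (EFin \o f) \_ `[a, b].
  apply/funext => x; rewrite patchE; case: ifPn => //= /negP xab.
  by rewrite f0// => xab'; apply: xab; exact/mem_set.
have mab : measurable (`[a, b]%classic : set (measurableTypeR R)).
  exact: measurable_itv.
apply: (iffLR (@integrable_mkcond _ _ R mu _ (EFin \o f) mab)).
apply: measurable_bounded_integrable => //.
- by rewrite /= lebesgue_measure_itv/=; case: ifP => _; rewrite ?ltry.
- exact: measurable_funTS.
- exists K; split; first by rewrite num_real.
  by move=> y Ky x _; exact: le_trans (fK x) (ltW Ky).
Qed.

Lemma Rintegral_shift f s : measurable_fun setT f ->
  mu.-integrable setT (EFin \o (fun x => f (x + s))) ->
  \int[mu]_x f (x + s) = \int[mu]_x f x.
Proof.
move=> mf fi; rewrite /Rintegral; congr fine.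
have ms : measurable_fun [set: measurableTypeR R] (fun x : R => x + s : measurableTypeR R).
  exact: measurable_funD.
transitivity (\int[pushforward mu (fun x : R => (x + s)%R : measurableTypeR R)]_x (f x)%:E)%E.
  rewrite (integral_pushforward ms _ fi)//; exact/measurable_EFinP.
by apply: eq_measure_integral => A mA _; exact: lebesgue_measure_shift.
Qed.

Lemma ae_lebesgue_neq (a : R) : {ae mu, forall x : R, x != a}.
Proof.
exists [set a]; split => //; first exact: lebesgue_measure_set1.
by move=> x /= /negP; rewrite negbK => /eqP.
Qed.

(** The cut-off creates jumps only at a and b, a null set; this gives the almost everywhere
    convergence of translates of the cut-off function. *)
Lemma restrict_itv_continuous (g : R -> R) (a b y : R) : continuous g ->
  y != a -> y != b -> {for y, continuous (g \_ `[a, b])}.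
Proof.
move=> cg ya yb.
have [yab|yab] := boolP (y \in `[a, b]).
  have yab' : y \in `]a, b[.
    by move: yab; rewrite !in_itv/= !lt_neqAle yb eq_sym ya.
  have e : \forall z \near y, g z = (g \_ `[a, b]) z.
    near=> z; rewrite patchE mem_set//=.
    apply: subset_itv_oo_cc; near: z; exact: near_in_itvoo.
  rewrite /prop_for /continuous_at patchE mem_set//.
  by apply: (cvg_trans (near_eq_cvg e)); exact: cg.
rewrite /prop_for /continuous_at [X in _ --> X](_ : _ = 0); last first.
  by rewrite patchE memNset//=; exact/negP.
have e : \forall z \near y, cst 0 z = (g \_ `[a, b]) z.
  near=> z; rewrite patchE memNset//= => zab.
have : (~` `[a, b]%classic) z; last by apply.
  near: z; apply: open_nbhs_nbhs; split; last exact/negP.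
  by apply: closed_openC; exact: interval_closed.
by apply: (cvg_trans (near_eq_cvg e)); exact: cvg_cst.
Unshelve. all: by end_near. Qed.

(** The [h k] have no common modulus of continuity, so a change of variables moves the shift onto
    the fixed function g cut off to [[0, 1]], whose translates converge almost everywhere. *)
Lemma cvg_integral_translate_continuous (g : R -> R) (K : R) (h : nat -> R -> R)
    (s : nat -> R) : continuous g -> (forall k, measurable_fun setT (h k)) ->
  (forall k x, `|h k x| <= K) -> s k @[k --> \oo] --> 0 ->
  \int[mu]_(y in `[0, 1]) (g y * (h k (y + s k) - h k y)) @[k --> \oo] --> 0.
Proof.
move=> cg mh hK s0.
(* A common bound on the shifts puts the supports of all translates of the cut-off function inside
   [[- D, 1 + D]], which makes a dominating function available. *)
have [D sD] : exists D : R, forall k, `|s k| <= D.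
  have /cvg_seq_bounded[D [_ Dbnd]] : cvgn s by apply/cvg_ex; exists 0.
  by exists (D + 1) => k; apply: (Dbnd (D + 1)) => //; rewrite ltrDl.
have [L gL] : exists L : R, forall x : R, `[0, 1]%classic x -> `|g x| <= L.
  have : compact (g @` `[0, 1]%classic).
    apply: continuous_compact; last exact: segment_compact.
    exact: continuous_subspaceT.
  move=> /compact_bounded[L [_ Lbnd]].
  exists (L + 1) => x x01; apply: (Lbnd (L + 1)); first by rewrite ltrDl.
  by exists x.
pose G : R -> R := g \_ `[0, 1].
have mg : measurable_fun setT g by exact: continuous_measurable_fun.
have mG : measurable_fun setT G.
  apply/(measurable_restrictT _ _).1 => //.
  exact: measurable_funTS.
have K0 : 0 <= K := le_trans (normr_ge0 _) (hK 0%N 0).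
have L0 : 0 <= L by apply: le_trans (normr_ge0 _) (gL 0 _); rewrite /= in_itv/= lexx ler01.
have GL (x : R) : `|G x| <= L.
  by rewrite /G patchE; case: ifPn => [/set_mem/gL//|_]; rewrite normr0.
have G0 (x : R) : ~ `[0, 1]%classic x -> G x = 0.
  by move=> x01; rewrite /G patchE memNset.
have msh (u : R -> R) (t : R) : measurable_fun setT u ->
    measurable_fun setT (fun x : R => u (x + t)).
  by move=> mu'; apply: (@measurableT_comp _ _ _ _ _ _ u) => //; exact: measurable_funD.
have step k : \int[mu]_(y in `[0, 1]) (g y * (h k (y + s k) - h k y)) =
    \int[mu]_y ((G (y - s k) - G y) * h k y).
  have i1 : mu.-integrable setT (EFin \o (fun y => G y * h k (y + s k))).
    apply: (@integrable_bounded_support _ 0 1 (L * K)).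
    - by apply: measurable_funM => //; exact: msh.
    - by move=> x; rewrite normrM ler_pM.
    - by move=> x x01; rewrite G0// mul0r.
  have i2 : mu.-integrable setT (EFin \o (fun y => G y * h k y)).
    apply: (@integrable_bounded_support _ 0 1 (L * K)).
    - exact: measurable_funM.
    - by move=> x; rewrite normrM ler_pM.
    - by move=> x x01; rewrite G0// mul0r.
  have i3 : mu.-integrable setT (EFin \o (fun y => G (y - s k) * h k y)).
    apply: (@integrable_bounded_support _ (s k) (1 + s k) (L * K)).
    - by apply: measurable_funM => //; exact: msh.
    - by move=> x; rewrite normrM ler_pM.
    - move=> x x01; rewrite G0 ?mul0r//= => xs; apply: x01.
      by move: xs; rewrite /= !in_itv/=; lra.
  rewrite Rintegral_mkcond.
  transitivity (\int[mu]_y (G y * h k (y + s k) - G y * h k y)).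
    apply: eq_Rintegral => y _; rewrite /G !patchE.
    by case: ifPn => _; rewrite ?mul0r ?subr0// mulrBr.
  rewrite RintegralB//.
  have -> : \int[mu]_y (G y * h k (y + s k)) = \int[mu]_y (G (y - s k) * h k y).
    rewrite -(@Rintegral_shift (fun y => G (y - s k) * h k y) (s k)).
    - by apply: eq_Rintegral => y _; rewrite addrK.
    - by apply: measurable_funM => //; exact: msh.
    - by under eq_fun do rewrite addrK.
  by rewrite -RintegralB//; apply: eq_Rintegral => y _; rewrite mulrBl.
under eq_cvg do rewrite step.
suff : \int[mu]_y ((G (y - s k) - G y) * h k y) @[k --> \oo] -->
    \int[mu]_y (0 : R) by rewrite Rintegral_cst// mul0r.
apply: (@Rdominated_convergence _ _ R mu setT
  (fun k y => (G (y - s k) - G y) * h k y) (fun=> 0)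
  (fun y => (2 * L * K) * \1_`[- D, 1 + D]%classic y)) => //.
- move=> k; have : measurable_fun setT (fun y : R => (G (y - s k) - G y) * h k y).
    apply: measurable_funM => //; apply: measurable_funB => //; exact: msh.
  exact.
- apply: (@filterS2 _ _ (ae_filter_ringOfSetsType mu) _ _ _ _
    (ae_lebesgue_neq 0) (ae_lebesgue_neq 1)) => y y0 y1 _.
  have cG := restrict_itv_continuous cg y0 y1.
  have GG : G (y - s k) - G y @[k --> \oo] --> 0.
    rewrite -(subrr (G y)); apply: cvgB; last exact: cvg_cst.
    apply: continuous_cvg => //.
    by rewrite -[X in _ --> X]subr0; apply: cvgB => //; exact: cvg_cst.
  apply: norm_cvg0; apply: (@squeeze_cvgr _ _ _ _ (cst 0) (fun k => `|G (y - s k) - G y| * K)).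
  + by near=> k; rewrite /= normr_ge0/= normrM ler_wpM2l.
  + exact: cvg_cst.
  + rewrite -(mul0r K); apply: cvgMl; rewrite -(@normr0 _ R); exact: cvg_norm.
- apply: (@integrable_bounded_support _ (- D) (1 + D) (2 * L * K)).
  + by apply: measurable_funM => //.
  + move=> x; rewrite indicE; case: (_ \in _); rewrite ?mulr1 ?mulr0 ?normr0 ?ger0_norm//; nra.
  + by move=> x xD; rewrite indicE memNset// mulr0.
- apply: aeW => y k _; rewrite indicE normrM.
  have [yD|yD] := boolP (y \in `[- D, 1 + D]%classic).
    rewrite mulr1 ler_pM// (le_trans (ler_normB _ _))// mulr_natl mulr2n lerD//.
  rewrite mulr0 G0; last first.
    move=> h01; move/negP: yD; apply; apply/mem_set; move: h01 (sD k).
    by rewrite /= !in_itv/= ler_norml; lra.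
  rewrite G0 ?subr0 ?normr0 ?mul0r// => h01; move/negP: yD; apply; apply/mem_set.
  by move: h01 (sD k); rewrite /= !in_itv/= ler_norml; lra.
Unshelve. all: by end_near. Qed.

(** Continuous functions are dense in L^1 on [[0, 1]], and the differences of [h k] are bounded by
    [2 * K] uniformly in k, so replacing f by a continuous approximation costs a small amount
    independent of k. *)
Lemma cvg_integral_translate f (K : R) (h : nat -> R -> R)
    (s : nat -> R) : bounded_mfun f -> (forall k, measurable_fun setT (h k)) ->
  (forall k x, `|h k x| <= K) -> s k @[k --> \oo] --> 0 ->
  \int[mu]_(y in `[0, 1]) (f y * (h k (y + s k) - h k y)) @[k --> \oo] --> 0.
Proof.
move=> [mf [L fL]] mh hK s0.
have K0 : 0 <= K := le_trans (normr_ge0 _) (hK 0%N 0).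
have m01 : measurable (`[0, 1]%classic : set (measurableTypeR R)).
  exact: measurable_itv.
have l01 : mu `[0, 1]%classic = 1%E.
  by rewrite lebesgue_measure_itv/= lte01 oppr0 adde0.
have if01 : mu.-integrable `[0, 1]%classic (EFin \o f).
  apply: measurable_bounded_integrable => //.
  - by rewrite /= l01 ltry.
  - exact: measurable_funTS.
  - exists L; split; first by rewrite num_real.
    by move=> y Ly x _; exact: le_trans (fL x) (ltW Ly).
have [g_ [cg ig fg]] := approximation_continuous_integrable m01
  (eq_ind_r (fun z => (z < +oo)%E) (ltry 1) l01) if01.
have mD k : measurable_fun setT (fun y : R => h k (y + s k) - h k y).
  apply: measurable_funB => //.
  by apply: (@measurableT_comp _ _ _ _ _ _ (h k)) => //; exact: measurable_funD.
have DK k (y : R) : `|h k (y + s k) - h k y| <= 2 * K.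
  by rewrite (le_trans (ler_normB _ _))// mulr_natl mulr2n lerD.
have iM (u : R -> R) k : mu.-integrable `[0, 1]%classic (EFin \o u) ->
    mu.-integrable `[0, 1]%classic
      (EFin \o (fun y => u y * (h k (y + s k) - h k y))).
  move=> iu; apply: (@integrableMl _ _ _ mu _ _ (EFin \o u)
    (fun y => h k (y + s k) - h k y)) => //.
    exact: measurable_funTS (mD k).
  exists (2 * K); split; first by rewrite num_real.
  by move=> y Ky x _; exact: le_trans (DK k x) (ltW Ky).
apply/cvgrPdist_lt => e e0.
(* The approximation error contributes at most [e / 2 * (2 * K / (2 * K + 1))], hence at most
   [e / 2]; the added 1 keeps the denominator positive when K is 0. *)
have e1 : 0 < e / (2 * (2 * K + 1)) by rewrite divr_gt0//; lra.
have /fine_cvgP[_ /cvgrPdist_lt/(_ _ e1)[n _ /(_ n (leqnn n))]] := fg.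
rewrite /= sub0r normrN => fgn.
have ifg : mu.-integrable `[0, 1]%classic (EFin \o (fun y => f y - g_ n y)).
  by have := integrableB m01 if01 (ig n).
have {}fgn : \int[mu]_(z in `[0, 1]) `|f z - g_ n z| < e / (2 * (2 * K + 1)).
  by apply: le_lt_trans fgn; exact: ler_norm.
have := @cvg_integral_translate_continuous (g_ n) K h s (cg n) mh hK s0.
move=> /cvgrPdist_lt/(_ _ (divr_gt0 e0 (ltr0n R 2)))[N _ Ng].
exists N => // k Nk; have := Ng k Nk.
rewrite /= !sub0r !normrN => gk.
have -> : \int[mu]_(y in `[0, 1]) (f y * (h k (y + s k) - h k y)) =
    \int[mu]_(y in `[0, 1]) ((f y - g_ n y) * (h k (y + s k) - h k y)) +
    \int[mu]_(y in `[0, 1]) (g_ n y * (h k (y + s k) - h k y)).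
  rewrite -RintegralD//; [|exact: iM|exact: iM].
  by apply: eq_Rintegral => y _; rewrite -mulrDl subrK.
rewrite (le_lt_trans (ler_normD _ _))// [ltRHS]splitr ler_ltD//.
have iabs := integrable_norm ifg.
have inM := integrable_norm (iM _ k ifg).
apply: le_trans (le_normr_Rintegral m01 (iM _ k ifg)) _.
have iK : mu.-integrable `[0, 1]%classic
    (EFin \o (fun y => `|f y - g_ n y| * (2 * K))).
  by have := integrableZr m01 (2 * K) iabs.
apply: (@le_trans _ _ (\int[mu]_(y in `[0, 1]) (`|f y - g_ n y| * (2 * K)))).
  apply: le_Rintegral => //= y _.
  by rewrite normrM ler_wpM2l.
rewrite RintegralZr//.
apply: (@le_trans _ _ (e / (2 * (2 * K + 1)) * (2 * K))).
  by rewrite ler_wpM2r ?mulr_ge0// ltW.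
have -> : e / (2 * (2 * K + 1)) * (2 * K) = e / 2 * (2 * K / (2 * K + 1)).
  by field; rewrite gt_eqF//; lra.
rewrite ler_piMr//; first by rewrite divr_ge0// ltW.
by rewrite ler_pdivrMr; lra.
Qed.

End translation.

(** * The function phi and its inverse *)

Section derivatives_on.
Context (R : realType).
Implicit Types (A : set R) (f : R -> R) (a b x : R).

Lemma derive_on_dist A f x e : derivable_on A f x -> 0 < e ->
  exists2 d : R, 0 < d & forall y, A y -> y != x -> `|x - y| < d ->
    `|derive_on A f x - diff_quotient f x y| < e.
Proof.
move=> /cvgrPdist_lt + e0 => /(_ e e0)/nbhs_ballP[d d0 dP].
exists d => // y Ay yx xyd.
exact: dP.
Qed.

Lemma derivable_on_continuous A f x : derivable_on A f x ->
  f y @[y --> within A (nbhs x)] --> f x.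
Proof.
move=> df; have [d d0 dP] := derive_on_dist df ltr01.
apply/cvgrPdist_lt => e e0.
pose l := `|derive_on A f x| + 1.
have l0 : 0 < l by rewrite ltr_wpDl.
apply/nbhs_ballP; exists (Num.min d (e / l)); first by rewrite /= lt_min d0 divr_gt0.
move=> y; rewrite /ball/= lt_min => /andP[xyd xye] Ay.
have [->|yx] := eqVneq y x; first by rewrite subrr normr0.
have yx0 : y - x != 0 by rewrite subr_eq0.
have -> : f x - f y = diff_quotient f x y * (x - y).
  by rewrite /diff_quotient; field.
rewrite normrM; apply: (@le_lt_trans _ _ (l * `|x - y|)).
  rewrite ler_wpM2r// /l -lerBlDl.
  apply: le_trans (lerB_dist _ _) _; rewrite distrC; exact/ltW/dP.
by rewrite mulrC -ltr_pdivlMr.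
Qed.

Lemma derivable_on_within_continuous A f :
  (forall x, A x -> derivable_on A f x) -> {within A, continuous f}.
Proof.
move=> df; apply/subspace_continuousP => x Ax.
by apply: derivable_on_continuous; exact: df.
Qed.

Lemma derivable_on_is_derive a b f x : x \in `]a, b[ ->
  derivable_on `[a, b] f x -> is_derive x 1 f (derive_on `[a, b] f x).
Proof.
move=> xab df.
suff cf : h^-1 *: (f (h *: 1 + x) - f x) @[h --> 0^'] --> derive_on `[a, b] f x.
  split; first by apply/cvg_ex; exists (derive_on `[a, b] f x).
  exact/cvg_lim.
apply/cvgrPdist_lt => e e0; have [d d0 dP] := derive_on_dist df e0.
have : \forall y \near x, y \in `]a, b[ by exact: near_in_itvoo.
move=> /nbhs_ballP[r /= r0 rP].
apply/nbhs_ballP; exists (Num.min d r); first by rewrite /= lt_min d0.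
move=> h; rewrite /ball/= lt_min sub0r normrN => /andP[hd hr] h0.
have hx : h *: 1 + x = x + h by rewrite addrC; congr (_ + _); exact: mulr1.
have xh : `|x - (x + h)| = `|h| by rewrite opprD addrA subrr sub0r normrN.
have := dP (x + h); rewrite xh hx /diff_quotient addrAC subrr add0r.
move=> /(_ _ _ hd); rewrite [_^-1 *: _]mulrC; apply.
  by apply: subset_itv_oo_cc; apply: rP; rewrite /ball/= xh.
by rewrite -subr_eq0 addrAC subrr add0r.
Qed.

Lemma derivable_on_lipschitz a b f K :
  (forall x, `[a, b]%classic x -> derivable_on `[a, b] f x) ->
  (forall x, `[a, b]%classic x -> `|derive_on `[a, b] f x| <= K) ->
  forall x y, x \in `[a, b] -> y \in `[a, b] -> `|f x - f y| <= K * `|x - y|.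
Proof.
move=> df fK x y; wlog xy : x y / x < y.
  move=> wl xab yab; have [xy|yx|->] := ltgtP x y; first exact: wl.
    by rewrite distrC [`|x - y|]distrC; exact: wl.
  by rewrite !subrr normr0 mulr0.
move=> xab yab.
have sub z : z \in `]x, y[ -> z \in `]a, b[.
  by move: xab yab; rewrite !in_itv/=; lra.
have sub' : `[x, y]%classic `<=` `[a, b]%classic.
  by move=> z /=; move: xab yab; rewrite !in_itv/=; lra.
have [||c /sub cab fyx] := @MVT _ f (derive_on `[a, b] f) x y xy.
- move=> z /sub zab; apply: derivable_on_is_derive => //.
  by apply: df; exact: subset_itv_oo_cc.
- apply: continuous_subspaceW sub' _; exact: derivable_on_within_continuous.
- rewrite distrC fyx normrM distrC ler_wpM2r//.
  by apply: fK; exact: subset_itv_oo_cc.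
Qed.

(** A nondegenerate interval has no isolated points. Properness of this filter makes limits of
    difference quotients along the interval unique. *)
Lemma itv_within_proper a b x : a < b -> x \in `[a, b] ->
  ProperFilter (within `[a, b] x^').
Proof.
move=> ab xab; apply: Build_ProperFilter_ex => P /nbhs_ballP[e /= e0 eP].
have [xb|xb] := ltP x b.
  pose y := x + Num.min (e / 2) (b - x).
  have m0 : 0 < Num.min (e / 2) (b - x) by rewrite lt_min divr_gt0//= subr_gt0.
  have m1 : Num.min (e / 2) (b - x) <= e / 2 by rewrite ge_min lexx.
  have m2 : Num.min (e / 2) (b - x) <= b - x by rewrite ge_min lexx orbT.
  exists y; apply: eP; rewrite /y.
  - by rewrite /ball/= opprD addrA subrr sub0r normrN gtr0_norm//; lra.
  - by rewrite -subr_eq0 addrAC subrr add0r gt_eqF.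
  - by move: xab; rewrite /= !in_itv/=; lra.
pose y := x - Num.min (e / 2) (x - a).
have ax : a < x by lra.
have m0 : 0 < Num.min (e / 2) (x - a) by rewrite lt_min divr_gt0//= subr_gt0.
have m1 : Num.min (e / 2) (x - a) <= e / 2 by rewrite ge_min lexx.
have m2 : Num.min (e / 2) (x - a) <= x - a by rewrite ge_min lexx orbT.
exists y; apply: eP; rewrite /y.
- by rewrite /ball/= opprB addrC subrK gtr0_norm//; lra.
- by rewrite -subr_eq0 addrAC subrr add0r oppr_eq0 gt_eqF.
- by move: xab; rewrite /= !in_itv/=; lra.
Qed.

Lemma derivable_on_FTC2 a b c d f :
  (forall x, `[a, b]%classic x -> derivable_on `[a, b] f x) ->
  {within `[a, b], continuous (derive_on `[a, b] f)} ->
  c \in `[a, b] -> d \in `[a, b] -> c < d ->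
  (\int[lebesgue_measure]_(x in `[c, d]) (derive_on `[a, b] f x)%:E =
  (f d - f c)%:E)%E.
Proof.
move=> df cdf cab dab cd; rewrite EFinB.
have sub z : z \in `]c, d[ -> z \in `]a, b[.
  by move: cab dab; rewrite !in_itv/=; lra.
have sub' : `[c, d]%classic `<=` `[a, b]%classic.
  by move=> z /=; move: cab dab; rewrite !in_itv/=; lra.
have isd z : z \in `]c, d[ -> is_derive z 1 f (derive_on `[a, b] f z).
  move=> /sub zab; apply: derivable_on_is_derive => //.
  by apply: df; exact: subset_itv_oo_cc.
have cf : {within `[c, d], continuous f}.
  by apply: continuous_subspaceW sub' _; exact: derivable_on_within_continuous.
apply: continuous_FTC2 => //.
- exact: continuous_subspaceW sub' _.
- have [_ c1 c2] := (continuous_within_itvP f cd).1 cf.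
  by split => // z zcd; by have [] := isd z zcd.
- by move=> z zcd; rewrite derive1E; by have [_ ->] := isd z zcd.
Qed.

End derivatives_on.

Section density_measure.
Context d (T : measurableType d) (R : realType)
  (m : {measure set T -> \bar R}) (w : T -> R).
Hypotheses (mw : measurable_fun setT w) (w_ge0 : forall x, 0 <= w x).

(** Made into a measure so that integrals of densities can be compared by uniqueness of measures
    agreeing on a generating family. *)
Definition density_measure (A : set T) : \bar R :=
  (\int[m]_(x in A) (w x)%:E)%E.

Let density_measure0 : density_measure set0 = 0%E.
Proof. exact: integral_set0. Qed.

Let density_measure_ge0 A : (0 <= density_measure A)%E.
Proof. by apply: integral_ge0 => x _; rewrite lee_fin. Qed.

Let density_measure_sigma_additive : semi_sigma_additive density_measure.
Proof.
apply: semi_sigma_additive_nng_induced; first exact/measurable_EFinP.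
by move=> x; rewrite lee_fin.
Qed.

HB.instance Definition _ := isMeasure.Build _ _ _ density_measure
  density_measure0 density_measure_ge0 density_measure_sigma_additive.

End density_measure.

(** * Derivative of the inverse, substitution along phi, extension of the inverse *)

Section effect_function.
Context (R : realType) (phi psi : R -> R).
Hypotheses (phi_maps : forall c, c \in `[0, 1] -> phi c \in `[0, 1])
    (phi_incr : {in `[0, 1] &, {homo phi : x y / x < y}})
    (phi_diff : forall c, c \in `[0, 1] -> derivable_on `[0, 1] phi c)
    (phi_diff2 : forall c, c \in `[0, 1] ->
       derivable_on `[0, 1] (derive_on `[0, 1] phi) c)
    (phi0 : phi 0 = 0) (phi1 : phi 1 = 1)
    (phiK : {in `[0, 1], cancel phi psi})
    (psi_diff : forall y, y \in `[0, 1] -> derivable_on `[0, 1] psi y).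
Notation mu := (@lebesgue_measure R).
Notation dphi := (derive_on `[0, 1] phi).
Notation dpsi := (derive_on `[0, 1] psi).

Let in0 : (0 : R) \in `[0, 1]. Proof. by rewrite in_itv/= lexx ler01. Qed.
Let in1 : (1 : R) \in `[0, 1]. Proof. by rewrite in_itv/= lexx ler01. Qed.

Lemma phi_continuous : {within `[0, 1], continuous phi}.
Proof. exact: derivable_on_within_continuous. Qed.

Lemma psi_continuous : {within `[0, 1], continuous psi}.
Proof. exact: derivable_on_within_continuous. Qed.

Lemma dphi_continuous : {within `[0, 1], continuous dphi}.
Proof. exact: derivable_on_within_continuous. Qed.

Lemma psi_surj y : y \in `[0, 1] -> psi y \in `[0, 1] /\ phi (psi y) = y.
Proof.
move=> y01; have [c c01 <-] : exists2 c, c \in `[0, 1] & phi c = y.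
  apply: IVT => //; first exact: phi_continuous.
  by rewrite phi0 phi1; move: y01; rewrite in_itv/= minEle maxEle ler01.
by rewrite phiK.
Qed.

Lemma phi_le : {in `[0, 1] &, {mono phi : x y / x <= y}}.
Proof. exact: le_mono_in. Qed.

Lemma phi_lt : {in `[0, 1] &, {mono phi : x y / x < y}}.
Proof. exact: leW_mono_in phi_le. Qed.

Lemma psi0 : psi 0 = 0. Proof. by rewrite -phi0 phiK. Qed.
Lemma psi1 : psi 1 = 1. Proof. by rewrite -phi1 phiK. Qed.

(** The difference quotients of phi at c and of psi at [phi c] are reciprocal. Passing to the limit
    in the second one needs [phi x] different from [phi c], which injectivity supplies. *)
Lemma dphi_dpsi c : c \in `[0, 1] -> dphi c * dpsi (phi c) = 1.
Proof.
move=> c01; have pF := itv_within_proper (@ltr01 R) c01.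
have cphi : phi x @[x --> within `[0, 1] c^'] --> within `[0, 1] (phi c)^'.
  move=> P /= /nbhs_ballP[e /= e0 eP].
  have /cvgrPdist_lt/(_ _ e0)/nbhs_ballP[d /= d0 dP] :=
    derivable_on_continuous (phi_diff c01).
  apply/nbhs_ballP; exists d => // x xd xc x01; apply: eP.
  - exact: dP.
  - by apply: contra xc => /eqP pxc; rewrite -(phiK x01) pxc phiK.
  - exact: phi_maps.
pose q x := diff_quotient phi c x * diff_quotient psi (phi c) (phi x).
have h : q x @[x --> within `[0, 1] c^'] --> dphi c * dpsi (phi c).
  apply: cvgM; first exact: phi_diff.
  exact: (cvg_comp _ _ cphi (psi_diff (phi_maps c01))).
suff h1 : q x @[x --> within `[0, 1] c^'] --> (1 : R).
  exact: (cvg_unique (@Rhausdorff R) h h1).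
apply: cvg_near_cst.
apply/nbhs_ballP; exists 1 => //= x _ xc x01.
rewrite /q /diff_quotient !phiK//.
have px : phi x - phi c != 0.
  by rewrite subr_eq0; apply: contra xc => /eqP pxc; rewrite -(phiK x01) pxc phiK.
by field; rewrite px subr_eq0 xc.
Qed.

Lemma dphi_ge0 c : c \in `[0, 1] -> 0 <= dphi c.
Proof.
move=> c01; have pF := itv_within_proper (@ltr01 R) c01.
apply: (limr_ge (phi_diff c01)).
apply/nbhs_ballP; exists 1 => //= x _ xc x01; rewrite /diff_quotient.
have [xc'|cx|e] := ltgtP x c; last by rewrite e eqxx in xc.
  by rewrite -mulrNN -invrN !opprB divr_ge0// subr_ge0 ltW// phi_lt.
by rewrite divr_ge0// subr_ge0 ltW// phi_lt.
Qed.

(** Strict monotonicity alone would allow critical points; differentiability of the inverse excludes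
    them. *)
Lemma dphi_gt0 c : c \in `[0, 1] -> 0 < dphi c.
Proof.
move=> c01; rewrite lt_neqAle dphi_ge0// andbT eq_sym.
by apply/eqP => d0; have /eqP := dphi_dpsi c01; rewrite d0 mul0r eq_sym oner_eq0.
Qed.

Lemma dpsiE y : y \in `[0, 1] -> dpsi y = (dphi (psi y))^-1.
Proof.
move=> /psi_surj[c01 e]; have := dphi_dpsi c01; rewrite e => h.
by apply: (mulfI (lt0r_neq0 (dphi_gt0 c01))); rewrite h divff// gt_eqF// dphi_gt0.
Qed.

(** By the formula for [dpsi], continuity follows from that of psi and of [dphi], the latter because
    phi is twice differentiable. It allows psi to be recovered from [dpsi] by integration. *)
Lemma dpsi_continuous : {within `[0, 1], continuous dpsi}.
Proof.
apply/subspace_continuousP => y y01.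
have [c01 _] := psi_surj y01.
have h : (dphi (psi x))^-1 @[x --> within `[0, 1] (nbhs y)] --> (dphi (psi y))^-1.
  apply: cvgV; first by rewrite gt_eqF// dphi_gt0.
  have /cvgrPdist_lt cd := derivable_on_continuous (phi_diff2 c01).
  have /cvgrPdist_lt cp := derivable_on_continuous (psi_diff y01).
  apply/cvgrPdist_lt => e /cd/nbhs_ballP[d /= d0 dP].
  have /nbhs_ballP[r /= r0 rP] := cp d d0.
  apply/nbhs_ballP; exists r => // x xr x01.
  by apply: dP; [exact: rP|exact: (psi_surj x01).1].
rewrite -(dpsiE y01) in h; apply: cvg_trans h; apply: near_eq_cvg.
by apply/nbhs_ballP; exists 1 => //= x _ x01; rewrite -(dpsiE x01).
Qed.

Lemma integral_dphi : \int[mu]_(c in `[0, 1]) dphi c = 1.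
Proof.
rewrite /Rintegral derivable_on_FTC2 ?phi0 ?phi1 ?subr0//.
exact: dphi_continuous.
Qed.

Lemma dpsi_ge0 y : y \in `[0, 1] -> 0 <= dpsi y.
Proof.
move=> y01; rewrite dpsiE// invr_ge0 dphi_ge0//; exact: (psi_surj y01).1.
Qed.

Let m01 : measurable (`[0, 1]%classic : set R).
Proof. exact: measurable_itv. Qed.

Lemma measurable_phi : measurable_fun setT (phi \_ `[0, 1]).
Proof.
apply/(measurable_restrictT _ _).1 => //.
apply: subspace_continuous_measurable_fun => //; exact: phi_continuous.
Qed.

Lemma measurable_dphi : measurable_fun setT (dphi \_ `[0, 1]).
Proof.
apply/(measurable_restrictT _ _).1 => //.
apply: subspace_continuous_measurable_fun => //; exact: dphi_continuous.
Qed.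

Lemma measurable_psi : measurable_fun setT (psi \_ `[0, 1]).
Proof.
apply/(measurable_restrictT _ _).1 => //.
apply: subspace_continuous_measurable_fun => //; exact: psi_continuous.
Qed.

Lemma measurable_dpsi : measurable_fun setT (dpsi \_ `[0, 1]).
Proof.
apply/(measurable_restrictT _ _).1 => //.
apply: subspace_continuous_measurable_fun => //; exact: dpsi_continuous.
Qed.

Let dpsi01_ge0 y : 0 <= (dpsi \_ `[0, 1]) y.
Proof. by rewrite patchE; case: ifPn => // /set_mem; exact: dpsi_ge0. Qed.

Notation I01 := (`[0, 1]%classic : set R).
Notation phi01 := (phi \_ `[0, 1]).
Notation dpsi01 := (dpsi \_ `[0, 1]).

(** Both sides are measures with the same mass on every ray above x: for x in [[0, 1[] the set where
    phi exceeds x is []psi x, 1]], of length [1 - psi x], which is also the integral of [dpsi] over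
    []x, 1]]. The indicator removes the points outside [[0, 1]], where [phi01] takes the dummy value
    0. *)
Lemma pushforward_phi_density (B : set R) : measurable B ->
  (\int[mu]_(c in phi01 @^-1` B) (\1_I01 c)%:E =
   \int[mu]_(y in B) (dpsi01 y)%:E)%E.
Proof.
have m1 : measurable_fun setT (\1_I01 : R -> R) by exact: measurable_indic.
have i0 (x : R) : 0 <= (\1_I01 : R -> R) x by rewrite indicE.
unshelve epose (n1 := density_measure mu (\1_I01 : R -> R) :
  {measure set (measurableTypeR R) -> \bar R}); [exact m1|exact i0|].
unshelve epose (n2 := density_measure mu dpsi01 :
  {measure set (measurableTypeR R) -> \bar R}); [exact measurable_dpsi|exact dpsi01_ge0|].
unshelve epose (n3 := pushforward n1 (phi01 : measurableTypeR R -> measurableTypeR R)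
  : {measure set (measurableTypeR R) -> \bar R}); first exact measurable_phi.
move=> mB.
suff : n3 B = n2 B by [].
(* Rays to the right are stable under intersection and generate the Borel sets; those starting at
   [- k%:R] exhaust the line and have finite mass. *)
apply: (@measure_unique _ R (measurableTypeR R) (@RGenOInfty.G R)
  (fun k => `]- k%:R, +oo[%classic) _ _ _ _ n3 n2 _ _ B mB) => //.
- exact: RGenOInfty.measurableE.
- move=> _ _ [x ->] [y ->]; exists (Num.max x y).
  apply/seteqP; split => z /=; rewrite !in_itv/= !andbT gt_max.
    by move=> [-> ->].
  by move=> /andP[].
- by move=> k; exists (- k%:R).
- apply/seteqP; split => // x _; exists (Num.trunc (- x)).+1 => //=.
  by rewrite in_itv/= andbT ltrNl truncnS_gt.
- move=> _ [x ->].
  rewrite /n3 /n2 /n1 /= /pushforward /density_measure.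
  have mx : measurable (`]x, +oo[%classic : set R) by exact: measurable_itv.
  rewrite integral_indic//; last first.
    by rewrite -[X in measurable X]setTI; exact: measurable_phi.
  apply: (@etrans _ _ (\int[mu]_(y in `]x, +oo[%classic `&` I01) (dpsi y)%:E)%E); last first.
    rewrite integral_mkcondr; apply: eq_integral => y _.
    by rewrite restrict_EFin.
  have FTC (c : R) : c \in `[0, 1] -> c < 1 ->
      (\int[mu]_(y in `]c, 1%R]) (dpsi y)%:E = (1 - psi c)%:E)%E.
    move=> c01 c1; rewrite integral_itv_obnd_cbnd; last first.
      apply/measurable_EFinP; apply: (@measurable_funS _ _ _ _ I01) => //.
        by move=> z; move: c01; rewrite /= !in_itv/=; lra.
      apply: subspace_continuous_measurable_fun => //; exact: dpsi_continuous.
    rewrite (derivable_on_FTC2 psi_diff dpsi_continuous c01 in1 c1).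
    by rewrite psi1.
  have [x0|x0] := ltP x 0.
    have -> : `]x, +oo[%classic `&` I01 = I01.
      by apply/seteqP; split => z /=; rewrite !in_itv/=; lra.
    rewrite (derivable_on_FTC2 psi_diff dpsi_continuous in0 in1)//.
    have -> : I01 `&` phi01 @^-1` `]x, +oo[ = I01.
      apply/seteqP; split => z /=; first by case.
      move=> z01; split=> //; rewrite patchE mem_set//=.
      by have := phi_maps z01; rewrite !in_itv/=; lra.
    by rewrite /= lebesgue_measure_itv/= lte01 psi0 psi1.
  have [x1|x1] := ltP x 1.
    have x01 : x \in `[0, 1] by rewrite in_itv/= x0 ltW.
    have [p01 pe] := psi_surj x01.
    have -> : `]x, +oo[%classic `&` I01 = `]x, 1]%classic.
      by apply/seteqP; split => z /=; rewrite !in_itv/=; lra.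
    rewrite FTC//.
    have -> : I01 `&` phi01 @^-1` `]x, +oo[ = `](psi x), 1]%classic.
      apply/seteqP; split => z /=.
        move=> [z01]; rewrite patchE mem_set//= in_itv/= andbT -{1}pe phi_lt//.
        by move: z01; rewrite !in_itv/=; lra.
      move=> zp; have z01 : z \in `[0, 1].
        by move: zp p01; rewrite !in_itv/=; lra.
      split=> //; rewrite patchE mem_set//= in_itv/= andbT -{1}pe phi_lt//.
      by move: zp; rewrite in_itv => /andP[].
    have p1 : psi x < 1 by rewrite -phi_lt// pe phi1.
    by rewrite /= lebesgue_measure_itv/= lte_fin p1.
  have -> : `]x, +oo[%classic `&` I01 = set0.
    by apply/seteqP; split => z //=; rewrite !in_itv/=; lra.
  have -> : I01 `&` phi01 @^-1` `]x, +oo[ = set0.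
    apply/seteqP; split => z //= [z01]; rewrite patchE mem_set//=.
    by have := phi_maps z01; rewrite !in_itv/=; lra.
  by rewrite integral_set0 measure0.
- move=> k; rewrite /n3 /n1 /= /pushforward /density_measure.
  have mx : measurable (`]- k%:R, +oo[%classic : set R) by exact: measurable_itv.
  rewrite integral_indic//; last first.
    by rewrite -[X in measurable X]setTI; exact: measurable_phi.
  apply: (@le_lt_trans _ _ (mu I01)).
    apply: le_measure; rewrite ?inE//.
    by apply: measurableI => //; rewrite -[X in measurable X]setTI; exact: measurable_phi.
  by rewrite /= lebesgue_measure_itv/= lte01 oppr0 adde0 ltry.
Qed.

Notation psi01 := (psi \_ `[0, 1]).

Let phi01E c : c \in `[0, 1] -> phi01 c = phi c.
Proof. by move=> c01; rewrite patchE mem_set. Qed.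

Let psi01E c : c \in `[0, 1] -> psi01 c = psi c.
Proof. by move=> c01; rewrite patchE mem_set. Qed.

Lemma ge0_integral_phi (F : R -> R) : measurable_fun setT F ->
  (forall y, 0 <= F y) ->
  (\int[mu]_(c in I01) (F (phi01 c))%:E =
   \int[mu]_(y in I01) (F y * dpsi y)%:E)%E.
Proof.
move=> mF F0.
have mI : measurable_fun setT (\1_I01 : R -> R) by exact: measurable_indic.
rewrite integral_mkcond [RHS]integral_mkcond.
have := @ge0_eq_integral_weighted_comp R _ _ _ _ _ _ mu mu phi01 id
  (\1_I01 : R -> R) dpsi01 (EFin \o F) measurable_phi (@measurable_id _ _ setT)
  mI measurable_dpsi.
move=> /(_ _ _ pushforward_phi_density) h.
have := h _ dpsi01_ge0 _ _; move=> {}h.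
transitivity (\int[mu]_c ((EFin \o F) (phi01 c) * (\1_I01 c)%:E))%E.
  apply: eq_integral => c _; rewrite patchE indicE; case: ifPn => _.
    by rewrite mule1.
  by rewrite mule0.
rewrite h.
- apply: eq_integral => y _; rewrite patchE [in RHS]patchE; case: ifPn => _.
    by rewrite EFinM.
  by rewrite mule0.
- by move=> x; rewrite indicE.
- exact/measurable_EFinP.
- by move=> y; rewrite lee_fin.
Qed.

Hypothesis dpsi_bounded : exists M : R, forall y, y \in `[0, 1] ->
  `|dpsi y| <= M.

Let bounded_integrable01 (f : R -> R) : measurable_fun setT f ->
  (exists K, forall x, x \in `[0, 1] -> `|f x| <= K) ->
  mu.-integrable I01 (EFin \o f).
Proof.
move=> mf [K fK]; apply: measurable_bounded_integrable => //.
- by rewrite /= lebesgue_measure_itv/= lte01 oppr0 adde0 ltry.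
- exact: measurable_funTS.
- exists K; split; first by rewrite num_real.
  by move=> y Ky x x01; exact: le_trans (fK x x01) (ltW Ky).
Qed.

Lemma bounded_dpsi : bounded_mfun dpsi01.
Proof.
split; first exact: measurable_dpsi.
have [M dM] := dpsi_bounded; exists (Num.max 0 M) => y; rewrite le_max.
rewrite patchE; case: ifPn => [/set_mem/dM ->|_]; first by rewrite orbT.
by rewrite normr0 lexx.
Qed.

Lemma Rintegral_phi (F : R -> R) : bounded_mfun F ->
  \int[mu]_(c in I01) F (phi01 c) = \int[mu]_(y in I01) (F y * dpsi01 y).
Proof.
move=> [mF [K FK]].
have K0 : 0 <= K := le_trans (normr_ge0 _) (FK 0).
have [mD [M DM]] := bounded_dpsi.
have key (G : R -> R) : measurable_fun setT G -> (forall y, 0 <= G y) ->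
    \int[mu]_(c in I01) G (phi01 c) = \int[mu]_(y in I01) (G y * dpsi01 y).
  move=> mG G0; rewrite /Rintegral ge0_integral_phi//; congr fine.
  by apply: eq_integral => y /set_mem y01; rewrite [dpsi01 y]patchE mem_set.
have iF : mu.-integrable I01 (EFin \o (fun c => F (phi01 c))).
  apply: bounded_integrable01; last by exists K => x _.
  by apply: (@measurableT_comp _ _ _ _ _ _ F) => //; exact: measurable_phi.
have iK : mu.-integrable I01 (EFin \o (fun c => K)).
  by apply: bounded_integrable01 => //; exists K => x _; rewrite ger0_norm.
have iFd : mu.-integrable I01 (EFin \o (fun y => F y * dpsi01 y)).
  apply: bounded_integrable01; first exact: measurable_funM.
  by exists (K * M) => x _; rewrite normrM ler_pM.
have iKd : mu.-integrable I01 (EFin \o (fun y => K * dpsi01 y)).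
  apply: bounded_integrable01; first exact: measurable_funM.
  by exists (K * M) => x _; rewrite normrM ler_pM// ger0_norm.
have h1 : \int[mu]_(c in I01) (F (phi01 c) + K) =
    \int[mu]_(y in I01) ((F y + K) * dpsi01 y).
  apply: (key (fun y => F y + K)); first exact: measurable_funD.
  by move=> y; have := FK y; rewrite ler_norml; lra.
have h2 : \int[mu]_(c in I01) K = \int[mu]_(y in I01) (K * dpsi01 y).
  exact: (key (fun=> K)).
rewrite -[LHS](addrK (\int[mu]_(y in I01) (K * dpsi01 y))) -{1}h2 -RintegralD// h1.
rewrite -RintegralB//; last first.
  apply: bounded_integrable01.
    by apply: measurable_funM => //; exact: measurable_funD.
  exists ((K + K) * M) => x _; rewrite normrM ler_pM//.
  by rewrite (le_trans (ler_normD _ _))// lerD// ger0_norm.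
by apply: eq_Rintegral => y _; rewrite mulrDl addrK.
Qed.

(** Substituting [y = phi c] turns [phi c + s k] into a translation of y. The bound on [dpsi] keeps
    the transformed weight [f (psi y) * dpsi y] bounded, as the translation lemma requires. *)
Lemma cvg_integral_phi_translate (f : R -> R) (K : R) (h : nat -> R -> R)
    (s : nat -> R) : bounded_mfun f -> (forall k, measurable_fun setT (h k)) ->
  (forall k x, `|h k x| <= K) -> s k @[k --> \oo] --> 0 ->
  \int[mu]_(c in I01) (f c * (h k (phi01 c + s k) - h k (phi01 c)))
    @[k --> \oo] --> 0.
Proof.
move=> bf mh hK s0.
have bfp : bounded_mfun (fun y => f (psi01 y)).
  exact: (bounded_mfun_comp bf measurable_psi).
have bfd : bounded_mfun (fun y => f (psi01 y) * dpsi01 y).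
  by apply: bounded_mfunM => //; exact: bounded_dpsi.
have := cvg_integral_translate bfd mh hK s0.
apply: cvg_trans; apply: near_eq_cvg; apply: nearW => k.
pose F y := f (psi01 y) * (h k (y + s k) - h k y).
have bF : bounded_mfun F.
  apply: bounded_mfunM => //; apply: bounded_mfunB; split => //.
  - by apply: (@measurableT_comp _ _ _ _ _ _ (h k)) => //; exact: measurable_funD.
  - by exists K => x; exact: hK.
  - by exists K.
transitivity (\int[mu]_(c in I01) F (phi01 c)).
  by rewrite (Rintegral_phi bF); apply: eq_Rintegral => y _; rewrite /F mulrAC.
apply: eq_Rintegral => c /set_mem c01.
by rewrite /F (phi01E c01) (psi01E (phi_maps c01)) (phiK c01).
Qed.

Definition clamp01 (y : R) : R := Num.max 0 (Num.min 1 y).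

Lemma clamp01_in y : clamp01 y \in `[0, 1].
Proof. by rewrite in_itv/= /clamp01 le_max lexx/= ge_max ler01 ge_min lexx. Qed.

Lemma clamp01_id y : y \in `[0, 1] -> clamp01 y = y.
Proof.
rewrite in_itv/= => /andP[y0 y1].
by rewrite /clamp01 (min_idPr y1) (max_idPr y0).
Qed.

Lemma clamp01_dist x y : `|clamp01 x - clamp01 y| <= `|x - y|.
Proof.
wlog xy : x y / x <= y.
  by move=> wl; have [/wl//|/ltW/wl] := leP x y; rewrite distrC [`|y - x|]distrC.
rewrite distrC [`|x - y|]distrC (ger0_norm (_ : 0 <= y - x)) ?subr_ge0//.
rewrite ler_norml /clamp01.
by case: (leP 1 x); case: (leP 1 y); case: (leP 0 x); case: (leP 0 y);
  case: (leP (0 : R) 1); lra.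
Qed.

(** The effect can leave [[0, 1]] when C is near an endpoint, so psi is continued by the constants 0
    and 1. Clamping is 1-Lipschitz, so a bound on [dpsi] is still a Lipschitz constant. *)
Definition psi_ext y := psi01 (clamp01 y).

Lemma measurable_psi_ext : measurable_fun setT psi_ext.
Proof.
apply: measurableT_comp; first exact: measurable_psi.
by apply: measurable_maxr => //; exact: measurable_minr.
Qed.

Lemma psi_extK c : c \in `[0, 1] -> psi_ext (phi01 c) = c.
Proof.
move=> c01; rewrite (phi01E c01) /psi_ext clamp01_id ?psi01E ?phiK//;
  exact: phi_maps.
Qed.

Lemma psi_ext_in y : psi_ext y \in `[0, 1].
Proof.
have h := clamp01_in y; rewrite /psi_ext psi01E//; exact: (psi_surj h).1.
Qed.

Lemma psi_ext_lipschitz M x y :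
  (forall y, y \in `[0, 1] -> `|dpsi y| <= M) ->
  `|psi_ext x - psi_ext y| <= M * `|x - y|.
Proof.
move=> dM; have M0 : 0 <= M := le_trans (normr_ge0 _) (dM 0 in0).
have h := derivable_on_lipschitz psi_diff dM (clamp01_in x) (clamp01_in y).
rewrite /psi_ext !psi01E ?clamp01_in//; apply: le_trans h _.
by rewrite ler_wpM2l// clamp01_dist.
Qed.

(** For nonzero n this is [- n] times the difference quotient of psi at [phi c] with increment
    [a k * n]. As c is interior, the shifted points eventually stay in [[0, 1]], where clamping has
    no effect. *)
Lemma cvg_psi_ext c n (a : nat -> R) : c \in `]0, 1[ ->
  (forall k, 0 < a k) -> a k @[k --> \oo] --> 0 ->
  (c - psi_ext (phi01 c + a k * n)) / a k @[k --> \oo] --> - n * dpsi01 (phi01 c).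
Proof.
move=> c01' a0 ca.
have c01 : c \in `[0, 1] by exact: subset_itv_oo_cc.
rewrite (phi01E c01); set y := phi c.
have y01 : y \in `[0, 1] by exact: phi_maps.
have y01' : y \in `]0, 1[.
  by rewrite in_itv/= -{1}phi0 -phi1 !phi_lt//; rewrite in_itv in c01'.
rewrite [dpsi01 y]patchE mem_set//.
have [->|n0] := eqVneq n 0.
  rewrite oppr0 mul0r; apply: cvg_near_cst; apply: nearW => k.
  rewrite mulr0 addr0 /y -(phi01E c01) psi_extK// subrr mul0r.
  by [].
apply/cvgrPdist_lt => e e0.
have en : 0 < e / `|n| by rewrite divr_gt0// normr_gt0.
have [d d0 dP] := derive_on_dist (psi_diff y01) en.
have can : y + a k * n @[k --> \oo] --> y.
  rewrite -[X in _ --> X]addr0 -[X in _ + X](mul0r n).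
  by apply: cvgD; [exact: cvg_cst|exact: cvgMl].
have near01 : \forall k \near \oo, y + a k * n \in `[0, 1].
  have : \forall z \near y, z \in `[0, 1].
    apply: filterS (near_in_itvoo y01') => z; exact: subset_itv_oo_cc.
  by move=> /can.
have neard : \forall k \near \oo, `|y - (y + a k * n)| < d.
  by move/cvgrPdist_lt: can; exact.
near=> k.
have z01 : y + a k * n \in `[0, 1] by near: k.
have zy : `|y - (y + a k * n)| < d by near: k.
have ak : a k != 0 by rewrite gt_eqF.
have yz : y + a k * n != y.
  by rewrite -subr_eq0 addrAC subrr add0r mulf_neq0.
have := dP _ z01 yz zy.
rewrite /psi_ext clamp01_id// psi01E// -[X in X - psi _](phiK c01) -/y.
rewrite /diff_quotient addrAC subrr add0r ltr_pdivlMr ?normr_gt0// -normrM.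
move=> h; rewrite (le_lt_trans _ h)// -normrN le_eqVlt; apply/orP; left.
apply/eqP; congr (`|_|); by field; rewrite ak n0.
Unshelve. all: by end_near. Qed.

End effect_function.

(** * Joint density of noise and cause *)

Section law_support.
Context d (T : measurableType d) (R : realType) (P : probability T R).

(** Points outside the support are covered by countably many null balls, with rational centres and
    radii [1 / (n + 1)]. *)
Lemma ae_law_support (X : T -> R) : measurable_fun setT X ->
  {ae P, forall w, law_support P X (X w)}.
Proof.
move=> mX.
have mB (x r : R) : measurable (X @^-1` ball x r).
  by rewrite -[X in measurable X]setTI; apply: mX => //; exact: measurable_ball.
pose B (q : rat * nat) : set T := X @^-1` ball (ratr q.1 : R) q.2.+1%:R^-1.
pose F k := if unpickle k is Some q then
  (if P (B q) == 0%E then B q else set0) else set0.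
have Fn k : P.-negligible (F k).
  rewrite /F; case: unpickle => [q|]; last exact: negligible_set0.
  case: ifPn => [/eqP q0|_]; last exact: negligible_set0.
  by exists (B q); split => //; exact: mB.
apply: negligibleS (negligible_bigcup Fn) => w /= /existsNP[e /not_implyP[e0]].
move=> /negP; rewrite lt_neqAle measure_ge0 andbT negbK => /eqP Pe.
(* As [1 / (n + 1) < e / 2], a rational centre closer than [1 / (n + 1)] to [X w] has its ball of
   that radius inside the null ball of radius e around [X w]. *)
pose n := Num.trunc (2 / e).
have ne : n.+1%:R^-1 < e / 2.
  have := truncnS_gt (2 / e); rewrite -/n => h.
  by rewrite -[ltRHS]invf_div ltf_pV2 ?posrE ?divr_gt0// ltr0n.
have hlt : X w - n.+1%:R^-1 < X w + n.+1%:R^-1.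
  by rewrite ltrBlDr -addrA ltrDl addr_gt0.
have [q qX] := rat_in_itvoo hlt.
exists (pickle (q, n)); first exact: I.
rewrite /F pickleK.
have qw : `|ratr q - X w| < n.+1%:R^-1.
  move: qX; rewrite in_itv/= ltr_norml.
  by move: (ratr q) (X w) (n.+1%:R^-1) => a b r /andP[]; lra.
have -> : P (B (q, n)) == 0%E.
  rewrite -measure_le0 [leRHS]Pe; apply: le_measure; rewrite ?inE; [exact: mB|exact: mB|].
  move=> v qv; suff : `|X w - X v| < e by [].
  have {}qv : `|ratr q - X v| < n.+1%:R^-1 := qv.
  move: (ratr q) (X w) (X v) qv qw ne => a b c; move: (n.+1%:R^-1) => r.
  by rewrite !ltr_norml; lra.
by rewrite /B /ball/=.
Qed.

End law_support.

(** If the marginal vanished, division by zero would make [cond_density] identically 0; its empty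
    support would lie in the empty interval, which does not contain [[nm, np]]. *)
Lemma smallest_itv_density (R : realType) (p : R * R -> R) (nm np c : R) :
  nm < np ->
  smallest_itv_containing (closure [set n | cond_density p c n != 0]) nm np ->
  marginal_density p c != 0 /\ forall n, n \notin `[nm, np] -> p (n, c) = 0.
Proof.
move=> nmp [sub small].
have m0 : marginal_density p c != 0.
  apply/eqP => m0.
  have S0 : closure [set n | cond_density p c n != 0] = set0.
    rewrite (_ : [set n | _] = set0) ?closure0//.
    by apply/seteqP; split => // n /=; rewrite /cond_density m0 invr0 mulr0 eqxx.
  have i0 : is_interval (set0 : set R) by move=> ? ? [].
  have := small set0 i0; rewrite S0 => /(_ (fun _ => id)) /(_ nm).
  by rewrite /= in_itv/= lexx ltW// => /(_ isT).
split=> // n nI; apply/eqP; apply: contraT => pn.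
have /subset_closure/sub : [set n | cond_density p c n != 0] n.
  by rewrite /= /cond_density mulf_neq0// invr_eq0.
by rewrite /= (negbTE nI).
Qed.

(** * Expectations as integrals against the joint and marginal densities *)

Section joint_density.
Context d (T : measurableType d) (R : realType) (P : probability T R)
  (C N : {RV P >-> R}) (p : R * R -> R) (nm np : R).
Notation mu := (@lebesgue_measure R).
Hypotheses (p_density : is_joint_density P N C p)
  (p_bounded : exists M : R, forall z, p z <= M)
  (C_range : law_support P C `<=` `[0, 1])
  (nmp : nm < np)
  (N_cond_range : forall c, c \in `[0, 1] -> smallest_itv_containing
         (closure [set n | cond_density p c n != 0]) nm np).
Notation I01 := (`[0, 1]%classic : set R).

Let mp : measurable_fun setT p := let: And3 h _ _ := p_density in h.
Let p0 z : 0 <= p z.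
Proof. by case: p_density. Qed.

Let mNC : measurable_fun setT (fun w => (N w, C w)).
Proof. exact: measurable_fun_pair. Qed.

Let measurable_preimage (X : {RV P >-> R}) (B : set R) : measurable B ->
  measurable (X @^-1` B).
Proof. by move=> mB; rewrite -[X in measurable X]setTI; exact: measurable_funPT. Qed.

Lemma ae_cause_in01 : {ae P, forall w, C w \in `[0, 1]}.
Proof.
have mC : measurable_fun setT C by exact: measurable_funPT.
by have := @ae_law_support _ _ _ P _ mC; apply: filterS => w /C_range.
Qed.

Lemma joint_density_set (A : set (R * R)) : measurable A ->
  P ((fun w => (N w, C w)) @^-1` A) = (\int[mu \x mu]_(z in A) (p z)%:E)%E.
Proof. by case: p_density => _ _; exact. Qed.

Lemma ge0_integral_joint_density (G : R * R -> R) : measurable_fun setT G ->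
  (forall z, 0 <= G z) ->
  (\int[P]_w (G (N w, C w))%:E = \int[mu \x mu]_z (G z * p z)%:E)%E.
Proof.
move=> mG G0.
have h := @ge0_eq_integral_weighted_comp R _ _ _ _ _ _ P (mu \x mu)%E
  (fun w => (N w, C w)) id (fun=> 1) p (EFin \o G) mNC (@measurable_id _ _ setT)
  (measurable_cst _) mp (fun=> ler01) p0.
transitivity (\int[P]_w ((EFin \o G) (N w, C w) * 1%:E))%E.
  by apply: eq_integral => w _; rewrite mule1.
rewrite h//.
- move=> B mB; rewrite integral_cst.
    by rewrite mul1e; exact: joint_density_set.
  by rewrite -[X in measurable X]setTI; exact: mNC.
- exact/measurable_EFinP.
Qed.

Lemma marginal_density_neq0 c : c \in `[0, 1] -> marginal_density p c != 0.
Proof. by move=> /N_cond_range/(smallest_itv_density nmp)[]. Qed.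

Lemma joint_density_out n c : c \in `[0, 1] -> n \notin `[nm, np] ->
  p (n, c) = 0.
Proof. by move=> /N_cond_range/(smallest_itv_density nmp)[_]; exact. Qed.

Lemma ae_noise_in_itv : {ae P, forall w, N w \in `[nm, np]}.
Proof.
pose A : set (R * R) := (~` `[nm, np]%classic) `*` I01.
have mA : measurable A.
  by apply: measurableX; [apply: measurableC; exact: measurable_itv|exact: measurable_itv].
have PA : P ((fun w => (N w, C w)) @^-1` A) = 0%E.
  rewrite joint_density_set//; apply: integral0_eq => -[n c] [/= /negP nI cI].
  by rewrite joint_density_out.
have nA : {ae P, forall w, ~ A (N w, C w)}.
  exists ((fun w => (N w, C w)) @^-1` A); split => //.
    by rewrite -[X in measurable X]setTI; exact: mNC.
  by move=> w /= /contrapT.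
apply: filterS2 nA ae_cause_in01 => w /= nA cw.
apply/negPn/negP => nN; apply: nA; split => //=.
exact/negP.
Qed.

Lemma integrable_joint_density (G : R * R -> R) : bounded_mfun G ->
  (mu \x mu)%E.-integrable setT (EFin \o (fun z => G z * p z)).
Proof.
move=> [mG [K GK]].
have K0 : 0 <= K := le_trans (normr_ge0 _) (GK (0, 0)).
have mGp : measurable_fun setT (fun z => G z * p z) by exact: measurable_funM.
have mK : measurable_fun [set: R * R] (fun=> K) by exact: measurable_cst.
have mKp : measurable_fun setT (fun z => K * p z) by exact: measurable_funM.
apply/integrableP; split; first by apply/measurable_EFinP; exact: mGp.
apply: (@le_lt_trans _ _ (\int[mu \x mu]_z (K * p z)%:E)%E).
  apply: ge0_le_integral => //=.
  - apply/measurable_EFinP.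
    have : measurable_fun setT (fun z => `|G z * p z|) by exact: measurableT_comp.
    exact.
  - by apply/measurable_EFinP; exact: mKp.
  - by move=> z _; rewrite lee_fin normrM (ger0_norm (p0 z)) ler_wpM2r.
rewrite -(@ge0_integral_joint_density (fun=> K))//.
by rewrite integral_cst//= probability_setT mule1 ltry.
Qed.

Lemma Rintegral_joint_density (G : R * R -> R) : bounded_mfun G ->
  \int[P]_w G (N w, C w) = \int[(mu \x mu)%E]_z (G z * p z).
Proof.
move=> bG; have [mG [K GK]] := bG.
have K0 : 0 <= K := le_trans (normr_ge0 _) (GK (0, 0)).
have bK : bounded_mfun (fun _ : R * R => K) by exact: bounded_mfun_cst.
have bGK := bounded_mfunD bG bK.
have h1 : \int[P]_w (G (N w, C w) + K) = \int[(mu \x mu)%E]_z ((G z + K) * p z).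
  congr fine; rewrite -(@ge0_integral_joint_density (fun z => G z + K))//.
    exact: bGK.1.
  by move=> z; have := GK z; rewrite ler_norml; lra.
have h2 : \int[P]_w K = \int[(mu \x mu)%E]_z (K * p z).
  by congr fine; rewrite -(@ge0_integral_joint_density (fun z => K)).
have iG : P.-integrable setT (EFin \o (fun w => G (N w, C w))).
  by apply: bounded_integrable => //; exact: (bounded_mfun_comp bG mNC).
have iK : P.-integrable setT (EFin \o (fun w : T => K)).
  by apply: bounded_integrable => //; exact: bounded_mfun_cst.
rewrite -[LHS](addrK (\int[(mu \x mu)%E]_z (K * p z))) -{1}h2 -RintegralD// h1.
rewrite -RintegralB//; [|exact: integrable_joint_density..].
by apply: eq_Rintegral => z _; rewrite mulrDl addrK.
Qed.

(** Fubini with the noise in the outer integral, so that the shift of [phi c] by a fixed noise value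
    is constant in c. Boundedness of p makes the inner integral finite for every n, not merely for
    almost every n. *)
Lemma Rintegral_joint_density_itv (G : R * R -> R) : bounded_mfun G ->
  let D n := \int[mu]_(c in I01) (G (n, c) * p (n, c)) in
  measurable_fun setT (D \_ `[nm, np]) /\
  \int[P]_w G (N w, C w) = \int[mu]_(n in `[nm, np]) D n.
Proof.
move=> bG D.
pose A : set (R * R) := `[nm, np]%classic `*` I01.
have mA : measurable A by apply: measurableX; exact: measurable_itv.
(* The joint law is carried by the rectangle A, so the indicator changes G only on a null event. *)
pose H z := G z * \1_A z.
have bH : bounded_mfun H.
  apply: bounded_mfunM => //; split; first exact: measurable_indic.
  by exists 1 => z; rewrite indicE; case: (_ \in _); rewrite ?normr1 ?normr0.
have iH := integrable_joint_density bH.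
have mI01 : measurable (I01 : set (measurableTypeR R)) by exact: measurable_itv.
have [M pM] := p_bounded; have [mG [K GK]] := bG.
have iin n : mu.-integrable I01 (EFin \o (fun c => G (n, c) * p (n, c))).
  apply: measurable_bounded_integrable.
  - exact: measurable_itv.
  - by rewrite /= lebesgue_measure_itv/= lte01 oppr0 adde0 ltry.
  - have : measurable_fun [set: R] (fun c => G (n, c) * p (n, c)).
      by apply: measurable_funM; exact: measurable_fun_pair2.
    by apply: measurable_funS.
  - exists (K * M); split; first by rewrite num_real.
    move=> y Ky c _; rewrite /= normrM (le_trans _ (ltW Ky))// ler_pM//.
    by rewrite ger0_norm.
have DE n : fubini_F mu (EFin \o (fun z => H z * p z)) n = ((D \_ `[nm, np]) n)%:E.
  rewrite /fubini_F patchE; case: ifPn => [/set_mem nI|nI].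
    rewrite /D /Rintegral fineK; last first.
      exact: (integrable_fin_num mI01 (iin n)).
    rewrite [RHS]integral_mkcond; apply: eq_integral => c _.
    rewrite patchE /= /H indicE; case: ifPn => [/set_mem cI|cI].
      by rewrite mem_set ?mulr1.
    rewrite memNset ?mulr0 ?mul0r//= => -[_ /=] cI'; move/negP: cI; apply.
    exact/mem_set.
  apply: integral0_eq => c _; rewrite /= /H indicE memNset ?mulr0 ?mul0r//=.
  by move=> -[/= nI' _]; move/negP: nI; apply; exact/mem_set.
split.
  have h : measurable_fun setT (fubini_F mu (EFin \o (fun z => H z * p z))).
    exact: measurable_fubini_F iH.
  apply/measurable_EFinP.
  rewrite (_ : EFin \o _ = fubini_F mu (EFin \o (fun z => H z * p z))) //.
  by apply/funext => n; rewrite DE.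
transitivity (\int[P]_w H (N w, C w)).
  apply: ae_eq_Rintegral.
  - exact: (bounded_mfun_comp bG mNC).1.
  - exact: (bounded_mfun_comp bH mNC).1.
  - apply: filterS2 ae_cause_in01 ae_noise_in_itv => w cw nw.
    by rewrite /H indicE mem_set ?mulr1.
rewrite Rintegral_joint_density// [RHS]Rintegral_mkcond /Rintegral.
by rewrite -integral12_prod_meas1//; congr fine; apply: eq_integral => n _; exact: DE.
Qed.

Notation marg := (marginal_density p).

Let marg_ge0 c : 0 <= marg c.
Proof. exact: Rintegral_ge0. Qed.

(** Outside [[0, 1]] the integral of [p (n, c)] over n may be infinite, and the real-valued marginal
    would then be 0. The cut-off avoids this and loses nothing, since C lies in [[0, 1]] almost
    surely. *)
Let p01 (z : R * R) := p z * \1_I01 z.2.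

Let mp01 : measurable_fun setT p01.
Proof.
apply: measurable_funM => //.
by apply: (@measurableT_comp _ _ _ _ _ _ (\1_I01 : R -> R)).
Qed.

Let fubini_p01 c : fubini_G mu (EFin \o p01) c = ((marg \_ I01) c)%:E.
Proof.
rewrite /fubini_G patchE; case: ifPn => [/set_mem cI|cI]; last first.
  by apply: integral0_eq => n _; rewrite /= /p01 indicE (negbTE cI) mulr0.
have [M pM] := p_bounded.
rewrite /marginal_density /Rintegral fineK.
  by apply: eq_integral => n _; rewrite /= /p01 indicE mem_set ?mulr1.
apply: integrable_fin_num => //.
apply: (@integrable_bounded_support _ _ nm np M).
- exact: measurable_fun_pair1.
- by move=> n; rewrite ger0_norm.
- by move=> n /negP nI; rewrite joint_density_out.
Qed.

Lemma measurable_marginal : measurable_fun setT (marg \_ I01).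
Proof.
have p010 : forall z, (0 <= (EFin \o p01) z)%E.
  by move=> z; rewrite lee_fin mulr_ge0// indicE.
have mp01' : measurable_fun setT (EFin \o p01) by exact/measurable_EFinP.
have h : measurable_fun setT (fubini_G mu (EFin \o p01)).
  exact: measurable_fun_fubini_tonelli_G.
apply/measurable_EFinP.
rewrite (_ : EFin \o _ = fubini_G mu (EFin \o p01)) //.
by apply/funext => c; rewrite fubini_p01.
Qed.

Lemma cause_density (B : set R) : measurable B ->
  P (C @^-1` B) = (\int[mu]_(c in B) ((marg \_ I01) c)%:E)%E.
Proof.
move=> mB.
have mA : measurable (setT `*` (B `&` I01) : set (R * R)).
  by apply: measurableX => //; apply: measurableI => //; exact: measurable_itv.
transitivity (P ((fun w => (N w, C w)) @^-1` (setT `*` (B `&` I01)))).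
  rewrite -[X in P X = _]setIT -[X in _ = P X]setIT.
  have e : ae_eq P setT (\1_(C @^-1` B) : T -> R)
      (\1_((fun w => (N w, C w)) @^-1` (setT `*` (B `&` I01))) : T -> R).
    apply: filterS ae_cause_in01 => w cw _; rewrite !indicE; congr (_%:R).
    congr (nat_of_bool _); apply/idP/idP => /set_mem.
      by move=> h; apply/mem_set; split => //; split.
    by move=> [_ [h _]]; exact/mem_set.
  have m1 : measurable (C @^-1` B) by exact: measurable_preimage.
  have m2 : measurable ((fun w => (N w, C w)) @^-1` (setT `*` (B `&` I01))).
    by rewrite -[X in measurable X]setTI; exact: mNC.
  rewrite -!integral_indic//; apply: ae_eq_integral => //.
  - by apply/measurable_EFinP; exact: measurable_indic.
  - by apply/measurable_EFinP; exact: measurable_indic.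
  - by apply: filterS e => w h _; rewrite h.
rewrite joint_density_set// integral_mkcond.
pose H (z : R * R) := p01 z * \1_B z.2.
have mH : measurable_fun setT (EFin \o H).
  apply/measurable_EFinP; apply: measurable_funM => //.
  by apply: (@measurableT_comp _ _ _ _ _ _ (\1_B : R -> R)) => //; exact: measurable_indic.
have H0 z : (0 <= (EFin \o H) z)%E.
  by rewrite lee_fin /H /p01 !mulr_ge0// indicE.
transitivity (\int[mu \x mu]_z (EFin \o H) z)%E.
  apply: eq_integral => -[n c] _; rewrite patchE /= /H /p01 !indicE /=.
  have [cB|cB] := boolP (c \in B); have [cI|cI] := boolP (c \in I01).
  - rewrite mem_set ?mulr1//; split => //; split; exact/set_mem.
  - rewrite memNset ?mulr0 ?mul0r// => -[_ [_ /= h]]; move/negP: cI; apply.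
    exact/mem_set.
  - rewrite memNset ?mulr0// => -[_ [/= h _]]; move/negP: cB; apply.
    exact/mem_set.
  - rewrite memNset ?mulr0// => -[_ [/= h _]]; move/negP: cB; apply.
    exact/mem_set.
rewrite fubini_tonelli2// [RHS]integral_mkcond; apply: eq_integral => c _.
rewrite patchE -fubini_p01 /fubini_G; case: ifPn => cB.
  by apply: eq_integral => n _; rewrite /= /H indicE cB mulr1.
by apply: integral0_eq => n _; rewrite /= /H indicE (negbTE cB) mulr0.
Qed.

Let ge0_integral_cause (G : R -> R) : measurable_fun setT G ->
  (forall c, 0 <= G c) ->
  (\int[P]_w (G (C w))%:E = \int[mu]_c (G c * (marg \_ I01) c)%:E)%E.
Proof.
move=> mG G0.
have marg0 c : 0 <= (marg \_ I01) c by rewrite patchE; case: ifP.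
have mC : measurable_fun setT C by exact: measurable_funPT.
have h := @ge0_eq_integral_weighted_comp R _ _ _ _ _ _ P mu
  C id (fun=> 1) (marg \_ I01) (EFin \o G) mC (@measurable_id _ _ setT)
  (measurable_cst _) measurable_marginal (fun=> ler01) marg0.
transitivity (\int[P]_w ((EFin \o G) (C w) * 1%:E))%E.
  by apply: eq_integral => w _; rewrite mule1.
rewrite h//.
- move=> B mB; rewrite integral_cst; first by rewrite mul1e; exact: cause_density.
  exact: measurable_preimage.
- exact/measurable_EFinP.
Qed.

(** G is assumed integrable rather than bounded because it will contain [cond_var], a chosen version
    that need not be bounded. *)
Lemma Rintegral_cause (G : R -> R) : measurable_fun setT G ->
  P.-integrable setT (EFin \o (fun w => G (C w))) ->
  \int[mu]_(c in I01) (G c * marg c) = \int[P]_w G (C w).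
Proof.
move=> mG iG.
have key (F : R -> R) : measurable_fun setT F -> (forall c, 0 <= F c) ->
    P.-integrable setT (EFin \o (fun w => F (C w))) ->
    mu.-integrable setT (EFin \o (fun c => F c * (marg \_ I01) c)) /\
    \int[mu]_c (F c * (marg \_ I01) c) = \int[P]_w F (C w).
  move=> mF F0 iF; split; last by rewrite /Rintegral ge0_integral_cause.
  have mFm : measurable_fun setT (fun c => F c * (marg \_ I01) c).
    by apply: measurable_funM => //; exact: measurable_marginal.
  apply/integrableP; split; first exact/measurable_EFinP.
  under eq_integral => c _.
    rewrite gee0_abs; last first.
      by rewrite lee_fin mulr_ge0// patchE; case: ifP.
    over.
  rewrite -ge0_integral_cause//.
  have /fin_numPlt/andP[] // := integrable_fin_num measurableT iF.
have mGp : measurable_fun setT G^\+ by exact: measurable_funrpos.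
have mGn : measurable_fun setT G^\- by exact: measurable_funrneg.
have iGp : P.-integrable setT (EFin \o (fun w => G^\+ (C w))) := integrable_funrpos measurableT iG.
have iGn : P.-integrable setT (EFin \o (fun w => G^\- (C w))) := integrable_funrneg measurableT iG.
have [i1 e1] := key _ mGp (fun c => funrpos_ge0 _ c) iGp.
have [i2 e2] := key _ mGn (fun c => funrneg_ge0 _ c) iGn.
have GE c : G c = G^\+ c - G^\- c by rewrite -[in LHS](funrposBneg G).
transitivity (\int[mu]_c (G^\+ c * (marg \_ I01) c - G^\- c * (marg \_ I01) c)).
  rewrite Rintegral_mkcond; apply: eq_Rintegral => c _.
  rewrite -mulrBl -GE !patchE; case: ifP => // _; exact/esym/mulr0.
rewrite RintegralB// e1 e2 -RintegralB//.
by apply: eq_Rintegral => w _; rewrite -GE.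
Qed.

Lemma ae_cause_neq a : {ae P, forall w, C w != a}.
Proof.
exists (C @^-1` [set a]); split.
- exact: measurable_preimage.
- by rewrite cause_density// integral_set1.
- by move=> w /= /negP; rewrite negbK => /eqP.
Qed.

Lemma ae_noise_neq0 : {ae P, forall w, N w != 0}.
Proof.
have mA : measurable ([set 0] `*` setT : set (R * R)) by exact: measurableX.
exists ((fun w => (N w, C w)) @^-1` ([set 0] `*` setT)); split.
- by rewrite -[X in measurable X]setTI; exact: mNC.
- rewrite joint_density_set//; apply: null_set_integral => //.
    by apply: measurable_funTS; exact/measurable_EFinP.
  have m1 : measurable ([set 0] : set (measurableTypeR R)) by exact: measurable_set1.
  apply: (etrans (product_measure1E mu mu m1 measurableT)).
  by rewrite /= lebesgue_measure_set1 mul0e.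
- by move=> w /= /negP; rewrite negbK => /eqP.
Qed.

(** The marginal is nonzero at every point of [[0, 1]], so a subset of [[0, 1]] that C almost surely
    avoids is Lebesgue null. This carries the equality case from the law of C over to the integral
    of [dphi]. *)
Lemma ae_lebesgue_cause (f : R -> R) (a : R) : measurable_fun setT f ->
  {ae P, forall w, f (C w) = a} -> {ae mu, forall c, I01 c -> f c = a}.
Proof.
move=> mf fC.
pose B := [set c | f c != a] `&` I01.
have mB : measurable B.
  apply: measurableI; last exact: measurable_itv.
  rewrite (_ : [set c | _] = f @^-1` (~` [set a])).
    by rewrite -[X in measurable X]setTI; apply: mf => //; exact: measurableC.
  by apply/seteqP; split => c /= /eqP.
have : P (C @^-1` B) = 0%E.
  apply/negligibleP; first exact: measurable_preimage.
  by apply: negligibleS fC => w /= [/eqP].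
rewrite cause_density// => B0.
exists B; split => //; last first.
  by move=> c /= /not_implyP[cI fc]; split => //; exact/eqP.
have : ae_eq mu B (EFin \o (marg \_ I01)) (cst 0%E).
  apply/ae_eq_integral_abs => //.
    apply/measurable_EFinP; apply: measurable_funTS; exact: measurable_marginal.
  rewrite -[RHS]B0; apply: eq_integral => c _; rewrite gee0_abs// lee_fin patchE.
  by case: ifP.
move=> h; apply: (iffLR (@negligibleP _ (measurableTypeR R) R mu B mB)).
apply: negligibleS h => c cB hc.
have := EFin_inj (hc cB); rewrite patchE mem_set; last by case: cB.
by apply/eqP; apply: marginal_density_neq0; case: cB.
Qed.

End joint_density.

(** * The limit of the error ratio *)

Section bounded_variables.
Context d (T : measurableType d) (R : realType) (P : probability T R).
Implicit Types V W : T -> R.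

Lemma bounded_RintegralD V W : bounded_mfun V -> bounded_mfun W ->
  \int[P]_w (V w + W w) = \int[P]_w V w + \int[P]_w W w.
Proof. by move=> bV bW; rewrite RintegralD//; exact: bounded_integrable. Qed.

Lemma bounded_RintegralB V W : bounded_mfun V -> bounded_mfun W ->
  \int[P]_w (V w - W w) = \int[P]_w V w - \int[P]_w W w.
Proof. by move=> bV bW; rewrite RintegralB//; exact: bounded_integrable. Qed.

Lemma bounded_RintegralZl V r : bounded_mfun V ->
  \int[P]_w (r * V w) = r * \int[P]_w V w.
Proof. by move=> bV; rewrite RintegralZl//; exact: bounded_integrable. Qed.

(* [(V - W) * (V + W) = V ^+ 2 - W ^+ 2] *)
Lemma eq_second_moment V W : bounded_mfun V -> bounded_mfun W ->
  \int[P]_w ((V w - W w) * V w) = 0 -> \int[P]_w ((V w - W w) * W w) = 0 ->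
  \int[P]_w V w ^+ 2 = \int[P]_w W w ^+ 2.
Proof.
move=> bV bW h1 h2; apply/eqP; rewrite -subr_eq0.
have bVW := bounded_mfunB bV bW.
rewrite -bounded_RintegralB; [|exact: bounded_mfunX..].
rewrite (_ : \int[P]_w _ = \int[P]_w ((V w - W w) * V w + (V w - W w) * W w)).
  by rewrite bounded_RintegralD ?h1 ?h2 ?addr0//; exact: bounded_mfunM.
by apply: eq_Rintegral => w _; ring.
Qed.

End bounded_variables.

(** * Both conditional variances and their ratio in the limit of small noise *)

Section main.
Context d (T : measurableType d) (R : realType)
    (P : probability T R) (C N : {RV P >-> R}) (p : R * R -> R)
    (phi psi : R -> R) (nm np : R).
Hypotheses (p_density : is_joint_density P N C p)
    (p_bounded : exists M : R, forall z, p z <= M)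
    (N_centered : {ae distribution P C, forall c, cond_exp P N C c = 0})
    (phi_maps : forall c, c \in `[0, 1] -> phi c \in `[0, 1])
    (phi_incr : {in `[0, 1] &, {homo phi : x y / x < y}})
    (phi_diff : forall c, c \in `[0, 1] -> derivable_on `[0, 1] phi c)
    (phi_diff2 : forall c, c \in `[0, 1] ->
       derivable_on `[0, 1] (derive_on `[0, 1] phi) c)
    (phi0 : phi 0 = 0) (phi1 : phi 1 = 1)
    (phiK : {in `[0, 1], cancel phi psi})
    (psi_diff : forall y, y \in `[0, 1] -> derivable_on `[0, 1] psi y)
    (dpsi_bounded : exists M : R, forall y, y \in `[0, 1] ->
       `|derive_on `[0, 1] psi y| <= M)
    (C_range : law_support P C `<=` `[0, 1])
    (np_gt0 : 0 < np) (nm_lt0 : nm < 0)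
    (N_cond_range : forall c, c \in `[0, 1] ->
       smallest_itv_containing
         (closure [set n | cond_density p c n != 0]) nm np)
    (mean_var_N : mean_cond_var P N C = 1%E).
Notation mu := (@lebesgue_measure R).
Notation I01 := (`[0, 1]%classic : set R).
Notation dphi := (derive_on `[0, 1] phi).
Notation dpsi := (derive_on `[0, 1] psi).
Notation phi01 := (phi \_ `[0, 1]).
Notation dphi01 := (dphi \_ `[0, 1]).
Notation dpsi01 := (dpsi \_ `[0, 1]).
Notation psi_ext := (psi_ext psi).

Let nmp : nm < np. Proof. exact: lt_trans np_gt0. Qed.

(** Clipping, like [clamp01] for C, changes the noise on a null event only and gives a version
    bounded at every point. *)
Let clip (n : R) : R := Num.max nm (Num.min np n).
Let N' w := clip (N w).
Let C' w := clamp01 (C w).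

Let clip_in n : clip n \in `[nm, np].
Proof. by rewrite in_itv/= /clip le_max lexx/= ge_max ge_min lexx/= andbT ltW. Qed.

Let clip_id n : n \in `[nm, np] -> clip n = n.
Proof.
rewrite in_itv/= => /andP[n0 n1].
by rewrite /clip (min_idPr n1) (max_idPr n0).
Qed.

Let clip_norm n : `|clip n| <= np - nm.
Proof. by have := clip_in n; rewrite in_itv/= ler_norml; move: np_gt0 nm_lt0; lra. Qed.

Let mC : measurable_fun setT C. Proof. exact: measurable_funPT. Qed.
Let mN : measurable_fun setT N. Proof. exact: measurable_funPT. Qed.

Let bclip : bounded_mfun clip.
Proof.
split; last by exists (np - nm).
by apply: measurable_maxr => //; exact: measurable_minr.
Qed.

Let bN' : bounded_mfun N'.
Proof. exact: (bounded_mfun_comp bclip mN). Qed.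

Let bclamp : bounded_mfun (@clamp01 R).
Proof.
split; first by apply: measurable_maxr => //; exact: measurable_minr.
exists 1 => y; have := clamp01_in y; rewrite in_itv/= ler_norml; lra.
Qed.

Let bC' : bounded_mfun C'.
Proof. exact: (bounded_mfun_comp bclamp mC). Qed.

Let NN' : {ae P, forall w, N w = N' w}.
Proof.
have := ae_noise_in_itv p_density C_range nmp N_cond_range.
by apply: filterS => w nw; rewrite /N' clip_id.
Qed.

Let CC' : {ae P, forall w, C w = C' w}.
Proof.
have := ae_cause_in01 C_range.
by apply: filterS => w cw; rewrite /C' clamp01_id.
Qed.

Let cond_mean_N0 : {ae P, forall w, cond_exp P N C (C w) = 0}.
Proof.
have [A [mA A0 sub]] := N_centered.
exists (C @^-1` A); split => //; last by move=> w; exact: sub.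
by rewrite -[X in measurable X]setTI; exact: mC.
Qed.

(** Since [E[N | C]] vanishes almost surely, the representative h in the description of the
    conditional variance drops out, and [cond_var P N C] is a conditional expectation of the squared
    noise. *)
Let noise_props :
  [/\ forall u, bounded_mfun u -> \int[P]_w (u (C w) * N' w) = 0,
      \int[P]_w N' w ^+ 2 = 1,
      is_cond_exp P (fun w => N' w ^+ 2) C (cond_var P N C) &
      P.-integrable setT (EFin \o (fun w => N' w ^+ 2))].
Proof.
have N'K w : `|N' w| <= np - nm by exact: clip_norm.
have [h [[mh hK] hE h_orth cV mV]] :=
  @mean_cond_var_bounded _ _ _ P N N' C _ mC mN bN'.1 N'K NN'.
have h0 : {ae P, forall w, h (C w) = 0}.
  by apply: filterS2 hE cond_mean_N0 => w <-.
have bh : bounded_mfun h by split => //; exists (np - nm).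
have bhC : bounded_mfun (fun w => h (C w)) by exact: (bounded_mfun_comp bh mC).
have bNh : bounded_mfun (fun w => N' w - h (C w)) by exact: bounded_mfunB.
have ae2 : {ae P, forall w, (N' w - h (C w)) ^+ 2 = N' w ^+ 2}.
  by apply: filterS h0 => w ->; rewrite subr0.
split.
- move=> u bu; rewrite -(h_orth u bu).
  have buC : bounded_mfun (fun w => u (C w)) by exact: (bounded_mfun_comp bu mC).
  apply: ae_eq_Rintegral.
  + exact: (bounded_mfunM buC bN').1.
  + exact: (bounded_mfunM buC bNh).1.
  + by apply: filterS h0 => w ->; rewrite subr0.
- move: mV; rewrite mean_var_N => -[->]; apply: ae_eq_Rintegral.
  + exact: (bounded_mfunX 2 bN').1.
  + exact: (bounded_mfunX 2 bNh).1.
  + by apply: filterS ae2 => w ->.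
- apply: is_cond_exp_ae_eq cV => //.
  + exact: (bounded_mfunX 2 bNh).1.
  + exact: (bounded_mfunX 2 bN').1.
- by apply: bounded_integrable => //; exact: bounded_mfunX.
Qed.

Let noise_orth u : bounded_mfun u -> \int[P]_w (u (C w) * N' w) = 0.
Proof. by have [h _ _ _] := noise_props; exact: h. Qed.

Let noise_var1 : \int[P]_w N' w ^+ 2 = 1.
Proof. by have [] := noise_props. Qed.

Let bdphi : bounded_mfun dphi01.
Proof.
split; first exact: measurable_dphi.
have : compact (dphi @` I01).
  apply: continuous_compact; last exact: segment_compact.
  exact: dphi_continuous.
move=> /compact_bounded[L [_ Lbnd]].
exists (Num.max 0 (L + 1)) => y; rewrite le_max patchE.
case: ifPn => [/set_mem y01|_]; last by rewrite normr0 lexx.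
by apply/orP; right; apply: (Lbnd (L + 1)); [rewrite ltrDl|exists y].
Qed.

(** Integrals against the marginal become expectations in C, where the conditional variance may be
    replaced by the squared noise. The product of integrals in the hypothesis is [1 * 1]: [dphi]
    integrates to [phi 1 - phi 0], and the mean conditional variance of the noise is 1. *)
Let uncorrelated_noise (uncorrelated :
       \int[lebesgue_measure]_(c in `[0, 1])
          (derive_on `[0, 1] phi c * cond_var P N C c * marginal_density p c)
       - (\int[lebesgue_measure]_(c in `[0, 1]) derive_on `[0, 1] phi c) *
         (\int[lebesgue_measure]_(c in `[0, 1])
            (cond_var P N C c * marginal_density p c)) = 0) :
  \int[P]_w (dphi01 (C w) * N' w ^+ 2) = 1.
Proof.
have [_ _ cV iN2] := noise_props.
have [mv iv vE] := cV.
have b1 : bounded_mfun (fun _ : R => 1 : R) by exact: bounded_mfun_cst.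
have key u : bounded_mfun u ->
    \int[mu]_(c in I01) ((u c * cond_var P N C c) * marginal_density p c) =
    \int[P]_w (u (C w) * N' w ^+ 2).
  move=> bu; have [mu' [K uK]] := bu.
  have iuv : P.-integrable setT
      (EFin \o (fun w => u (C w) * cond_var P N C (C w))).
    apply: (@integrableMr _ _ _ _ _ _ (fun w => u (C w))
      (EFin \o (fun w => cond_var P N C (C w)))) => //.
      exact: measurableT_comp.
    exists K; split; first by rewrite num_real.
    by move=> y Ky w _; exact: le_trans (uK _) (ltW Ky).
  rewrite (@Rintegral_cause _ _ _ _ _ _ _ nm np p_density p_bounded C_range nmp
    N_cond_range (fun c => u c * cond_var P N C c))//; last first.
    exact: measurable_funM.
  have := is_cond_exp_integral mC iN2 cV bu.
  have iuN : P.-integrable setT (EFin \o (fun w => u (C w) * N' w ^+ 2)).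
    apply: bounded_integrable => //; apply: bounded_mfunM; last exact: bounded_mfunX.
    exact: (bounded_mfun_comp bu mC).
  under eq_Rintegral do rewrite mulrBr.
  by rewrite RintegralB// => /eqP; rewrite subr_eq0 => /eqP ->.
move: uncorrelated.
rewrite integral_dphi// mul1r.
have -> : \int[mu]_(c in I01) (cond_var P N C c * marginal_density p c) = 1.
  transitivity (\int[mu]_(c in I01) ((1 * cond_var P N C c) * marginal_density p c)).
    by apply: eq_Rintegral => c _; rewrite mul1r.
  rewrite (key _ b1); apply: etrans noise_var1.
  by apply: eq_Rintegral => w _; rewrite mul1r.
move=> /eqP; rewrite subr_eq0 => /eqP h; rewrite -key//; apply: etrans h.
by apply: eq_Rintegral => c /set_mem c01; rewrite patchE mem_set.
Qed.

Let mphi01 : measurable_fun setT phi01.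
Proof. exact: measurable_phi. Qed.

Let bphi : bounded_mfun phi01.
Proof.
split; first exact: mphi01.
exists 1 => y; rewrite patchE; case: ifPn => [/set_mem y01|_].
  by have := phi_maps y01; rewrite in_itv/= ler_norml; lra.
by rewrite normr0.
Qed.

Notation Eff a := (rescaled_effect phi C N nm np a).
Let width a := 1 + a * np - a * nm.

Let width_gt0 a : 0 < a -> 0 < width a.
Proof.
move=> a0; rewrite /width -addrA ltr_wpDr// -mulrBr mulr_ge0 ?ltW// subr_gt0.
exact: nmp.
Qed.

Let measurable_effect a : measurable_fun setT (Eff a).
Proof.
apply: measurable_funM => //; apply: measurable_funB => //.
apply: measurable_funD; first exact: measurableT_comp mphi01 mC.
exact: measurable_funM.
Qed.

Let mean_cond_var_effect a : 0 < a ->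
  mean_cond_var P (Eff a) C = (((width a)^-1 * a) ^+ 2)%:E.
Proof.
move=> a0; set s := (width a)^-1.
pose g c := s * (phi01 c - a * nm).
have bg : bounded_mfun g.
  apply: bounded_mfunM; first exact: bounded_mfun_cst.
  by apply: bounded_mfunB => //; exact: bounded_mfun_cst.
pose Z w := g (C w) + s * a * N' w.
have bgC : bounded_mfun (fun w => g (C w)) by exact: (bounded_mfun_comp bg mC).
have bsN : bounded_mfun (fun w => s * a * N' w).
  by apply: bounded_mfunM => //; exact: bounded_mfun_cst.
have bZ : bounded_mfun Z by exact: bounded_mfunD.
have [mZ [K ZK]] := bZ.
have EZ : {ae P, forall w, Eff a w = Z w}.
  apply: filterS NN' => w; rewrite /Z /rescaled_effect /effect /g => ->.
  by rewrite -/(width a) -/s; ring.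
have [h [[mh hK] _ h_orth _ ->]] :=
  mean_cond_var_bounded mC (@measurable_effect a) mZ ZK EZ.
have bh : bounded_mfun h by split => //; exists K.
have bhC : bounded_mfun (fun w => h (C w)) by exact: (bounded_mfun_comp bh mC).
congr (_%:E).
transitivity (\int[P]_w (s * a * N' w) ^+ 2).
  have b1 : bounded_mfun (fun w => Z w - h (C w)) by exact: bounded_mfunB.
  (* [g (C w)] is the conditional mean of the effect. The residuals [Z w - h (C w)] and
     [s * a * N' w] differ by a function of C, to which both are orthogonal. *)
  apply: eq_second_moment => //.
  - rewrite -(h_orth (fun c => g c - h c)); last exact: bounded_mfunB.
    by apply: eq_Rintegral => w _; rewrite /Z; ring.
  - transitivity (\int[P]_w (s * a * ((g (C w) - h (C w)) * N' w))).
      by apply: eq_Rintegral => w _; rewrite /Z; ring.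
    rewrite bounded_RintegralZl.
      by rewrite (noise_orth (bounded_mfunB bg bh)) mulr0.
    by apply: bounded_mfunM => //; exact: bounded_mfunB.
transitivity (\int[P]_w ((s * a) ^+ 2 * N' w ^+ 2)).
  by apply: eq_Rintegral => w _; rewrite exprMn.
by rewrite bounded_RintegralZl ?noise_var1 ?mulr1//; exact: bounded_mfunX.
Qed.

(* The error of predicting the cause by [psi_ext] of the effect, divided by
   the size of the noise. *)
Let X a w := (C' w - psi_ext (phi01 (C' w) + a * N' w)) / a.

(** By the Lipschitz bound on [psi_ext] the numerator is at most M times the displacement [a * N' w]
    in absolute value, and a cancels. Uniformity in a is what dominated convergence needs. *)
Let X_bounded : exists K, forall a, 0 < a -> forall w, `|X a w| <= K.
Proof.
have [M dM] := dpsi_bounded; exists (M * (np - nm)) => a a0 w.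
have M0 : 0 <= M.
  by apply: le_trans (normr_ge0 _) (dM 0 _); rewrite in_itv/= lexx ler01.
rewrite /X normrM normfV (gtr0_norm a0) ler_pdivrMr// -mulrA.
rewrite -{1}(@psi_extK _ phi psi phi_maps phiK (C' w)); last exact: clamp01_in.
have := psi_ext_lipschitz psi_diff (phi01 (C' w)) (phi01 (C' w) + a * N' w) dM.
move=> /le_trans; apply; rewrite ler_wpM2l//.
rewrite opprD addrA subrr sub0r normrN normrM (gtr0_norm a0) [leLHS]mulrC.
by apply: ler_wpM2r; [exact: ltW|exact: clip_norm].
Qed.

Let mX a : measurable_fun setT (X a).
Proof.
apply: measurable_funM => //; apply: measurable_funB; first exact: bC'.1.
apply: (@measurableT_comp _ _ _ _ _ _ psi_ext).
  exact: measurable_psi_ext.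
apply: measurable_funD; first exact: (bounded_mfun_comp bphi bC'.1).1.
by apply: measurable_funM => //; exact: bN'.1.
Qed.

(** The cause is a function of the effect plus [a * X], so its mean conditional variance is that of
    [a * X]. Here [delta] represents [E[X | effect]], with a bound independent of a. *)
Let mean_cond_var_cause : exists K, forall a, 0 < a ->
  exists2 delta : R -> R, (measurable_fun setT delta /\ forall x, `|delta x| <= K) &
    mean_cond_var P C (Eff a) = (a ^+ 2 *
      (\int[P]_w X a w ^+ 2 - \int[P]_w (delta (Eff a w) * X a w)))%:E.
Proof.
have [K XK] := X_bounded; exists K => a a0.
have mE := @measurable_effect a.
have bX : bounded_mfun (X a) by split; [exact: mX|exists K; exact: XK].
have XX : {ae P, forall w, X a w = X a w} by exact: aeW.
have [delta [[md dK] _ d_orth _ _]] :=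
  mean_cond_var_bounded mE (@mX a) (@mX a) (XK a a0) XX.
have C'1 w : `|C' w| <= 1.
  by have := clamp01_in (C w); rewrite in_itv/= ler_norml -/(C' w); lra.
have [h [[mh hK] _ h_orth _ ->]] := mean_cond_var_bounded mE mC bC'.1 C'1 CC'.
exists delta => //; congr (_%:E).
have bd : bounded_mfun delta by split => //; exists K.
have bh : bounded_mfun h by split => //; exists 1.
have bdE : bounded_mfun (fun w => delta (Eff a w)) by exact: (bounded_mfun_comp bd mE).
have bhE : bounded_mfun (fun w => h (Eff a w)) by exact: (bounded_mfun_comp bh mE).
(* The argument of [psi_ext] undoes the rescaling, so u of the rescaled effect is the prediction of
   C from [phi01 (C w) + a * N w]. *)
pose u q := psi_ext (width a * q + a * nm).
have bu : bounded_mfun u.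
  split.
    apply: (@measurableT_comp _ _ _ _ _ _ psi_ext); first exact: measurable_psi_ext.
    by apply: measurable_funD => //; exact: measurable_funM.
  exists 1 => q; rewrite /u.
  have := @psi_ext_in _ phi psi phi_diff phi0 phi1 phiK (width a * q + a * nm).
  by rewrite in_itv/= ler_norml; lra.
have uE : {ae P, forall w, C' w = u (Eff a w) + a * X a w}.
  apply: filterS2 NN' CC' => w nw cw.
  rewrite /X mulrC divfK ?gt_eqF// /u /rescaled_effect /effect -/(width a).
  by rewrite mulVKf ?gt_eqF ?width_gt0// subrK nw cw addrC subrK.
have bXd : bounded_mfun (fun w => X a w - delta (Eff a w)) by exact: bounded_mfunB.
have baXd : bounded_mfun (fun w => a * (X a w - delta (Eff a w))).
  by apply: bounded_mfunM => //; exact: bounded_mfun_cst.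
have bCh : bounded_mfun (fun w => C' w - h (Eff a w)) by exact: bounded_mfunB.
(* The residuals of the cause and of [a * X] differ by v of the effect, and both are orthogonal to
   functions of the effect. *)
pose v q := u q + a * delta q - h q.
have bv : bounded_mfun v.
  apply: bounded_mfunB => //; apply: bounded_mfunD => //.
  by apply: bounded_mfunM => //; exact: bounded_mfun_cst.
have bvE : bounded_mfun (fun w => v (Eff a w)) by exact: (bounded_mfun_comp bv mE).
have bdiff : bounded_mfun (fun w => C' w - h (Eff a w) - a * (X a w - delta (Eff a w))).
  exact: bounded_mfunB.
have vE : {ae P, forall w,
    C' w - h (Eff a w) - a * (X a w - delta (Eff a w)) = v (Eff a w)}.
  by apply: filterS uE => w ->; rewrite /v; ring.
have e1 : \int[P]_w (C' w - h (Eff a w)) ^+ 2 =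
    \int[P]_w (a * (X a w - delta (Eff a w))) ^+ 2.
  apply: eq_second_moment => //.
  - rewrite -(h_orth v bv); apply: ae_eq_Rintegral.
    + exact: (bounded_mfunM bdiff bCh).1.
    + exact: (bounded_mfunM bvE bCh).1.
    + by apply: filterS vE => w ->.
  - transitivity (\int[P]_w (a * (v (Eff a w) * (X a w - delta (Eff a w))))).
      apply: ae_eq_Rintegral.
      + exact: (bounded_mfunM bdiff baXd).1.
      + exact: (bounded_mfunM (bounded_mfun_cst _ a) (bounded_mfunM bvE bXd)).1.
      + by apply: filterS vE => w ->; rewrite mulrCA.
    by rewrite bounded_RintegralZl ?d_orth ?mulr0//; exact: bounded_mfunM.
rewrite e1.
(* The last term integrates to 0 by orthogonality, which leaves an expression linear in [delta], fit
   for testing against bounded functions. *)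
transitivity (\int[P]_w (a ^+ 2 * (X a w ^+ 2 - delta (Eff a w) * X a w
    - delta (Eff a w) * (X a w - delta (Eff a w))))).
  by apply: eq_Rintegral => w _; ring.
have bX2 : bounded_mfun (fun w => X a w ^+ 2) by exact: bounded_mfunX.
have bdX : bounded_mfun (fun w => delta (Eff a w) * X a w) by exact: bounded_mfunM.
have bdXd : bounded_mfun (fun w => delta (Eff a w) * (X a w - delta (Eff a w))).
  exact: bounded_mfunM.
rewrite bounded_RintegralZl.
  rewrite bounded_RintegralB//; last exact: bounded_mfunB.
  by rewrite d_orth// subr0 bounded_RintegralB.
by apply: bounded_mfunB => //; exact: bounded_mfunB.
Qed.

(** On [[0, 1]] this is the reciprocal of [dphi]; written through psi, it inherits its bound from
    the hypothesis on the inverse. *)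
Let kap c := dpsi01 (phi01 c).

Let bkap : bounded_mfun kap.
Proof.
apply: (bounded_mfun_comp _ mphi01).
exact: (bounded_dpsi phi_maps phi_incr).
Qed.

Let X0 w := - N' w * kap (C' w).

Let bX0 : bounded_mfun X0.
Proof.
apply: bounded_mfunM; last exact: (bounded_mfun_comp bkap bC'.1).
split; first by apply: measurableT_comp => //; exact: bN'.1.
by exists (np - nm) => w; rewrite normrN; exact: clip_norm.
Qed.

Let cvg_X (a : nat -> R) : (forall k, 0 < a k) -> a k @[k --> \oo] --> 0 ->
  {ae P, forall w, X (a k) w @[k --> \oo] --> X0 w}.
Proof.
move=> a0 ca.
(* C has a density, so it almost surely avoids the endpoints, where the shifted values could stay
   outside [[0, 1]] for every k. *)
have h0 := ae_cause_neq p_density p_bounded C_range nmp N_cond_range 0.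
have h1 := ae_cause_neq p_density p_bounded C_range nmp N_cond_range 1.
have h01 : {ae P, forall w, C w \in `]0, 1[}.
  have := ae_cause_in01 C_range; apply: filterS3 h0 h1 => w w0 w1.
  by rewrite !in_itv/= !lt_neqAle w1 eq_sym w0.
apply: filterS2 CC' h01 => w cw cI; rewrite /X /X0 -cw.
exact: (cvg_psi_ext phi_maps phi_incr).
Qed.

(** The [eta k] are only measurable and uniformly bounded because they will be unknown conditional
    expectations. Centredness of the noise cancels the correlation of X0 with [eta k (phi01 (C w))];
    the remaining difference is, for each noise value n, a translation by [a k * n]. *)
Let cvg_correlation (K : R) (a : nat -> R) (eta : nat -> R -> R) :
  (forall k, 0 < a k) -> a k @[k --> \oo] --> 0 ->
  (forall k, measurable_fun setT (eta k)) -> (forall k x, `|eta k x| <= K) ->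
  \int[P]_w (eta k (phi01 (C w) + a k * N w) * X0 w) @[k --> \oo] --> 0.
Proof.
move=> a0 ca me eK.
have be k : bounded_mfun (eta k) by split => //; exists K.
have bek k : bounded_mfun (fun c => eta k (phi01 c)).
  exact: (bounded_mfun_comp (be k) mphi01).
pose g (z : R * R) := - clip z.1 * kap z.2.
pose G k (z : R * R) := g z * (eta k (phi01 z.2 + a k * z.1) - eta k (phi01 z.2)).
have bG k : bounded_mfun (G k).
  apply: bounded_mfunM.
    apply: bounded_mfunM; last exact: (bounded_mfun_comp bkap measurable_snd).
    split; last by exists (np - nm) => z; rewrite normrN; exact: clip_norm.
    apply: measurableT_comp => //.
    exact: (bounded_mfun_comp bclip measurable_fst).1.
  apply: bounded_mfunB; last exact: (bounded_mfun_comp (bek k) measurable_snd).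
  apply: (bounded_mfun_comp (be k) (Q := fun z : R * R => phi01 z.2 + a k * z.1)).
  apply: measurable_funD; first exact: measurableT_comp mphi01 measurable_snd.
  by apply: measurable_funM => //; exact: measurable_fst.
have me1 k : bounded_mfun (fun w => eta k (phi01 (C w) + a k * N w)).
  apply: (bounded_mfun_comp (be k) (Q := fun w => phi01 (C w) + a k * N w)).
  apply: measurable_funD; first exact: measurableT_comp mphi01 mC.
  exact: measurable_funM.
have step k : \int[P]_w (eta k (phi01 (C w) + a k * N w) * X0 w) =
    \int[P]_w G k (N w, C w).
  have bu : bounded_mfun (fun c => - kap c * eta k (phi01 c)).
    apply: bounded_mfunM => //; split; last first.
      by have [K' kK] := bkap.2; exists K' => c; rewrite normrN.
    by apply: measurableT_comp => //; exact: bkap.1.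
  (* The added term, a function of C times the centred noise, integrates to 0 and restores what G
     subtracts. *)
  rewrite -[RHS]addr0 -[X in _ = _ + X](noise_orth bu) -bounded_RintegralD; last 2 first.
  - exact: (bounded_mfun_comp (bG k) (measurable_fun_pair mN mC)).
  - by apply: bounded_mfunM => //; exact: (bounded_mfun_comp bu mC).
  apply: ae_eq_Rintegral.
  - exact: (bounded_mfunM (me1 k) bX0).1.
  - apply: measurable_funD.
      exact: (bounded_mfun_comp (bG k) (measurable_fun_pair mN mC)).1.
    by apply: measurable_funM; [exact: (bounded_mfun_comp bu mC).1|exact: bN'.1].
  - apply: filterS CC' => w cw; rewrite /X0 -cw /G /g /=.
    by rewrite -/(N' w); ring.
have [M pM] := p_bounded.
have [_ [Kk kK]] := bkap.
pose D k n := \int[mu]_(c in I01) (G k (n, c) * p (n, c)).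
have DE k : measurable_fun setT (D k \_ `[nm, np]) /\
    \int[P]_w G k (N w, C w) = \int[mu]_(n in `[nm, np]) D k n.
  exact: (Rintegral_joint_density_itv p_density p_bounded C_range nmp N_cond_range (bG k)).
have mI01 : measurable (I01 : set (measurableTypeR R)) by exact: measurable_itv.
have p0 z : 0 <= p z by case: p_density.
have Kk0 : 0 <= Kk := le_trans (normr_ge0 _) (kK 0).
have K0 : 0 <= K := le_trans (normr_ge0 _) (eK 0%N 0).
have M0 : 0 <= M := le_trans (p0 (0, 0)) (pM (0, 0)).
(* The factors bound the noise, [kap], the difference of two values of [eta k], and p. B depends on
   neither k nor n, as dominated convergence in n requires. *)
pose B := (np - nm) * Kk * (2 * K) * M.
have GpB k n c : `|G k (n, c) * p (n, c)| <= B.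
  rewrite normrM /B ler_pM//; last by rewrite ger0_norm.
  rewrite /G normrM ler_pM//.
    rewrite /g normrM ler_pM// normrN; exact: clip_norm.
  by rewrite (le_trans (ler_normB _ _))// mulr_natl mulr2n lerD.
have mGp k n : measurable_fun [set: R] (fun c => G k (n, c) * p (n, c)).
  apply: measurable_funM; first by apply: measurable_fun_pair2; exact: (bG k).1.
  by apply: measurable_fun_pair2; case: p_density.
have I01lty : (mu I01 < +oo)%E.
  by rewrite /= lebesgue_measure_itv/= lte01 oppr0 adde0 ltry.
have iGp k n : mu.-integrable I01 (EFin \o (fun c => G k (n, c) * p (n, c))).
  apply: measurable_bounded_integrable => //.
  - exact: measurable_funTS (mGp k n).
  - exists B; split; first by rewrite num_real.
    by move=> y By c _; exact: le_trans (GpB k n c) (ltW By).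
have DB k n : `|D k n| <= B.
  apply: le_trans (le_normr_Rintegral mI01 (iGp k n)) _.
  have iB : mu.-integrable I01 (EFin \o (fun=> B)).
    apply: measurable_bounded_integrable => //.
    exists `|B|; split; first by rewrite num_real.
    by move=> y By c _; exact: ltW.
  apply: le_trans (le_Rintegral mI01 (integrable_norm (iGp k n)) iB (fun c _ => GpB k n c)) _.
  by rewrite Rintegral_cst//= lebesgue_measure_itv/= lte01 oppr0 adde0/= mulr1.
have D0 n : D k n @[k --> \oo] --> 0.
  have bf : bounded_mfun (fun c => g (n, c) * p (n, c)).
    split.
      apply: measurable_funM; last by apply: measurable_fun_pair2; case: p_density.
      have : measurable_fun setT (fun c => - clip n * kap c).
        by apply: measurable_funM; [exact: measurable_cst|exact: bkap.1].
      exact.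
    exists ((np - nm) * Kk * M) => c; rewrite normrM ler_pM//; last by rewrite ger0_norm.
    rewrite /g normrM ler_pM// normrN; exact: clip_norm.
  have cs : a k * n @[k --> \oo] --> 0 by rewrite -(mul0r n); exact: cvgMl.
  have := cvg_integral_phi_translate phi_maps phi_incr phi_diff phi_diff2 phi0 phi1
    phiK psi_diff dpsi_bounded bf me eK cs.
  apply: cvg_trans; apply: near_eq_cvg; apply: nearW => k.
  by apply: eq_Rintegral => c _; rewrite /G; ring.
suff : \int[mu]_(n in `[nm, np]) D k n @[k --> \oo] -->
    \int[mu]_(n in `[nm, np]) (0 : R).
  rewrite Rintegral_cst ?mul0r; last exact: measurable_itv.
  apply: cvg_trans; apply: near_eq_cvg; apply: nearW => k.
  by rewrite step (DE k).2.
apply: (@Rdominated_convergence _ _ R mu `[nm, np]%classic D (fun=> 0) (fun=> B)).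
- exact: measurable_itv.
- move=> k; have := (DE k).1; have mI : measurable (`[nm, np]%classic : set R).
    exact: measurable_itv.
  by move/(measurable_restrictT (D k) mI).2.
- exact: measurable_cst.
- by apply: aeW => n _; exact: D0.
- apply: measurable_bounded_integrable.
  + exact: measurable_itv.
  + by rewrite /= lebesgue_measure_itv/=; case: ifP => _; rewrite ?ltry.
  + exact: measurable_cst.
  + exists `|B|; split; first by rewrite num_real.
    by move=> y By c _; exact: ltW.
- by apply: aeW => n k _; exact: DB.
Qed.

Let L := \int[P]_w X0 w ^+ 2.

Lemma cvg_error_ratio :
  error_ratio P phi C N nm np a @[a --> 0^'+] --> L.
Proof.
(* The limit is tested along arbitrary positive sequences tending to 0, to which dominated
   convergence applies. *)
apply/cvg_at_rightP => a [a0 ca].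
have [K XK] := X_bounded.
have [K' mcv] := mean_cond_var_cause.
have /choice[delta hdelta] : forall k, exists delta : R -> R,
    [/\ measurable_fun setT delta, forall x, `|delta x| <= K' &
    mean_cond_var P C (Eff (a k)) = (a k ^+ 2 *
      (\int[P]_w X (a k) w ^+ 2 -
       \int[P]_w (delta (Eff (a k) w) * X (a k) w)))%:E].
  by move=> k; have [delta [md dK] e] := mcv (a k) (a0 k); exists delta.
have md k : measurable_fun setT (delta k) by case: (hdelta k).
have dK k x : `|delta k x| <= K' by case: (hdelta k).
have K'0 : 0 <= K' := le_trans (normr_ge0 _) (dK 0%N 0).
have bd k : bounded_mfun (delta k) by split => //; exists K'.
have bdE k : bounded_mfun (fun w => delta k (Eff (a k) w)).
  exact: (bounded_mfun_comp (bd k) (@measurable_effect (a k))).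
have bX k : bounded_mfun (X (a k)) by split; [exact: mX|exists K; exact: XK].
have XX := cvg_X a0 ca.
have X0K : {ae P, forall w, `|X0 w| <= K}.
  apply: filterS XX => w Xw.
  have nXw : `|X (a k) w| @[k --> \oo] --> `|X0 w| by exact: cvg_norm.
  apply: (cvgr_to_le nXw); apply: nearW => k; exact: XK.
have i1 (r : R) : P.-integrable setT (EFin \o (fun=> r)).
  by apply: bounded_integrable => //; exact: bounded_mfun_cst.
have c1 : \int[P]_w X (a k) w ^+ 2 @[k --> \oo] --> L.
  apply: (@Rdominated_convergence _ _ _ P setT (fun k w => X (a k) w ^+ 2)
    (fun w => X0 w ^+ 2) (fun=> K ^+ 2)) => //.
  - by move=> k; exact: (bounded_mfunX 2 (bX k)).1.
  - exact: (bounded_mfunX 2 bX0).1.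
  - by apply: filterS XX => w Xw _; rewrite !expr2; exact: cvgM.
  - apply: aeW => w k _; rewrite normrX ler_sqr ?nnegrE//; first exact: XK.
    exact: le_trans (normr_ge0 _) (XK _ (a0 k) w).
(* However [delta k] varies with k, its uniform bound lets X be replaced by its limit X0. *)
have c2 : \int[P]_w (delta k (Eff (a k) w) * (X (a k) w - X0 w)) @[k --> \oo] --> 0.
  suff : \int[P]_w (delta k (Eff (a k) w) * (X (a k) w - X0 w)) @[k --> \oo] -->
    \int[P]_w (0 : R) by rewrite Rintegral_cst// mul0r.
  apply: (@Rdominated_convergence _ _ _ P setT
    (fun k w => delta k (Eff (a k) w) * (X (a k) w - X0 w))
    (fun=> 0) (fun=> K' * (2 * K))) => //.
  - by move=> k; exact: (bounded_mfunM (bdE k) (bounded_mfunB (bX k) bX0)).1.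
  - apply: filterS XX => w Xw _; apply: norm_cvg0.
    apply: (@squeeze_cvgr _ _ _ _ (cst 0) (fun k => K' * `|X (a k) w - X0 w|)).
    + by apply: nearW => k; rewrite /= normr_ge0/= normrM ler_wpM2r.
    + exact: cvg_cst.
    + rewrite -(mulr0 K'); apply: cvgMr; rewrite -(@normr0 _ R); apply: cvg_norm.
      by rewrite -(subrr (X0 w)); apply: cvgB => //; exact: cvg_cst.
  - apply: filterS X0K => w X0w k _; rewrite normrM ler_pM//.
    by rewrite (le_trans (ler_normB _ _))// mulr_natl mulr2n lerD// XK.
(* [eta k] absorbs the rescaling: [delta k] of the rescaled effect is [eta k] of
   [phi01 (C w) + a k * N w]. *)
pose eta k y := delta k ((width (a k))^-1 * (y - a k * nm)).
have me k : measurable_fun setT (eta k).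
  have : measurable_fun setT (fun y : R => (width (a k))^-1 * (y - a k * nm)).
    by apply: measurable_funM; [exact: measurable_cst|exact: measurable_funB].
  exact: measurableT_comp.
have c3 : \int[P]_w (delta k (Eff (a k) w) * X0 w) @[k --> \oo] --> 0.
  exact: (@cvg_correlation K' a eta a0 ca me (fun k y => dK k _)).
have c4 : \int[P]_w (delta k (Eff (a k) w) * X (a k) w) @[k --> \oo] --> 0.
  have : \int[P]_w (delta k (Eff (a k) w) * (X (a k) w - X0 w)) +
      \int[P]_w (delta k (Eff (a k) w) * X0 w) @[k --> \oo] --> (0 + 0 : R).
    by apply: cvgD; [exact: c2|exact: c3].
  rewrite addr0; apply: cvg_trans; apply: near_eq_cvg.
  apply: nearW => k; rewrite /= -bounded_RintegralD; last 2 first.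
  - by apply: bounded_mfunM => //; exact: bounded_mfunB.
  - exact: bounded_mfunM.
  by apply: eq_Rintegral => w _; ring.
have cw : width (a k) @[k --> \oo] --> (1 : R).
  have : 1 + a k * np - a k * nm @[k --> \oo] --> (1 + 0 * np - 0 * nm : R).
    by apply: cvgB; [apply: cvgD; [exact: cvg_cst|exact: cvgMl]|exact: cvgMl].
  by rewrite !mul0r addr0 subr0.
(* The denominator of the ratio is [((width a)^-1 * a) ^+ 2]: the factor [a ^+ 2] cancels, and the
   square of the width remains, which tends to 1. *)
have : width (a k) * width (a k) * (\int[P]_w X (a k) w ^+ 2 -
    \int[P]_w (delta k (Eff (a k) w) * X (a k) w)) @[k --> \oo] --> (1 * 1 * (L - 0) : R).
  apply: cvgM; first by apply: cvgM; exact: cw.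
  by apply: cvgB; [exact: c1|exact: c4].
rewrite !mul1r subr0.
apply: cvg_trans; apply: near_eq_cvg; apply: nearW => k.
rewrite /= /error_ratio mean_cond_var_effect//.
have [_ _ ->] := hdelta k.
by rewrite /=; field; rewrite !gt_eqF// width_gt0.
Qed.

(** * The bound on the limit and the case of equality *)

Section limit_value.
Hypothesis uncorrelated : \int[P]_w (dphi01 (C w) * N' w ^+ 2) = 1.

(* [1 / t ^+ 2 - 3 + 2 * t = (t - 1) ^+ 2 * (2 * t + 1) / t ^+ 2] *)
Let gap w := N' w ^+ 2 * (kap (C' w) ^+ 2 - 3 + 2 * dphi01 (C' w)).

Let kap_dphi w : 0 < dphi01 (C' w) /\ kap (C' w) = (dphi01 (C' w))^-1.
Proof.
have c01 : C' w \in `[0, 1] by exact: clamp01_in.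
have d0 : 0 < dphi (C' w) by exact: (dphi_gt0 phi_maps phi_incr phi_diff phiK psi_diff).
have pc : phi01 (C' w) = phi (C' w) by rewrite patchE mem_set.
have -> : dphi01 (C' w) = dphi (C' w) by rewrite patchE mem_set.
split=> //; rewrite /kap pc patchE mem_set/=; last exact: phi_maps.
apply: (mulfI (lt0r_neq0 d0)); rewrite divff ?gt_eqF//.
exact: (dphi_dpsi phi_maps phi_diff phiK psi_diff).
Qed.

Let gapE w : gap w = N' w ^+ 2 *
  ((dphi01 (C' w) - 1) ^+ 2 * (2 * dphi01 (C' w) + 1) / dphi01 (C' w) ^+ 2).
Proof.
rewrite /gap; have [d0 ->] := kap_dphi w; congr (_ * _); field.
by rewrite gt_eqF.
Qed.

Let gap_ge0 w : 0 <= gap w.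
Proof.
have [d0 _] := kap_dphi w; rewrite gapE mulr_ge0 ?sqr_ge0// divr_ge0 ?sqr_ge0//.
by rewrite mulr_ge0 ?sqr_ge0// addr_ge0// mulr_ge0// ltW.
Qed.

Let bdphiC' : bounded_mfun (fun w => dphi01 (C' w)).
Proof. exact: (bounded_mfun_comp bdphi bC'.1). Qed.

Let bgap : bounded_mfun gap.
Proof.
apply: bounded_mfunM; first exact: bounded_mfunX.
apply: bounded_mfunD; last first.
  by apply: bounded_mfunM => //; exact: bounded_mfun_cst.
apply: bounded_mfunB; last exact: bounded_mfun_cst.
by apply: bounded_mfunX; exact: (bounded_mfun_comp bkap bC'.1).
Qed.

(** The three terms of the gap integrate to L, -3 and 2, as the squared noise integrates to 1 both
    with and without the weight [dphi01]. *)
Let integral_gap : \int[P]_w gap w = L - 1.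
Proof.
have bN2 : bounded_mfun (fun w => N' w ^+ 2) by exact: bounded_mfunX.
have e : \int[P]_w (dphi01 (C' w) * N' w ^+ 2) = 1.
  apply: etrans uncorrelated; apply: ae_eq_Rintegral.
  - exact: (bounded_mfunM bdphiC' bN2).1.
  - exact: (bounded_mfunM (bounded_mfun_comp bdphi mC) bN2).1.
  - by apply: filterS CC' => w <-.
transitivity (\int[P]_w (X0 w ^+ 2 - 3 * N' w ^+ 2
    + 2 * (dphi01 (C' w) * N' w ^+ 2))).
  by apply: eq_Rintegral => w _; rewrite /gap /X0; ring.
have b3 : bounded_mfun (fun w => 3 * N' w ^+ 2).
  by apply: bounded_mfunM => //; exact: bounded_mfun_cst.
have bdN : bounded_mfun (fun w => dphi01 (C' w) * N' w ^+ 2) by exact: bounded_mfunM.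
have b2 : bounded_mfun (fun w => 2 * (dphi01 (C' w) * N' w ^+ 2)).
  by apply: bounded_mfunM => //; exact: bounded_mfun_cst.
rewrite bounded_RintegralD//; last by apply: bounded_mfunB => //; exact: bounded_mfunX.
rewrite bounded_RintegralB//; last exact: bounded_mfunX.
by rewrite !bounded_RintegralZl// e noise_var1 -/L; ring.
Qed.

Lemma limit_ge1 : 1 <= L.
Proof. by rewrite -subr_ge0 -integral_gap; exact: Rintegral_ge0. Qed.

(** Equality makes the nonnegative gap vanish almost surely. Since N is almost surely nonzero, this
    forces [dphi] to be 1 along C, hence Lebesgue almost everywhere on [[0, 1]], and integration
    from 0 recovers phi. *)
Lemma limit_eq1 : L = 1 -> forall c, c \in `[0, 1] -> phi c = c.
Proof.
move=> L1.
have gap0 : {ae P, forall w, gap w = 0}.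
  apply: ae_eq0_Rintegral => //; first exact: bounded_integrable.
  by rewrite integral_gap L1 subrr.
have dphi1 : {ae P, forall w, dphi01 (C w) = 1}.
  have n0 := ae_noise_neq0 p_density.
  apply: filterS3 gap0 n0 (filterI NN' CC') => w + nw [nn' cc'].
  have [d0 _] := kap_dphi w; rewrite gapE -nn' cc' => /eqP.
  have h : (2 * dphi01 (C' w) + 1 == 0) = false by rewrite gt_eqF//; lra.
  rewrite !mulf_eq0 invr_eq0 !expf_eq0/= (negbTE nw) (gt_eqF d0) h subr_eq0.
  by rewrite !orbF orbb => /eqP.
have dphi_ae := ae_lebesgue_cause p_density p_bounded C_range nmp N_cond_range
  bdphi.1 dphi1.
move=> c c01; have [->//|cn0] := eqVneq c 0.
have c0 : 0 < c by move: c01; rewrite in_itv/= lt_neqAle eq_sym cn0 => /andP[].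
have i0 : (0 : R) \in `[0, 1] by rewrite in_itv/= lexx ler01.
have := derivable_on_FTC2 phi_diff (dphi_continuous phi_diff2) i0 c01 c0.
rewrite phi0 subr0 => h; apply: EFin_inj; rewrite -h.
have sub : `[0, c]%classic `<=` I01.
  by move=> x; move: c01; rewrite /= !in_itv/=; lra.
have mc : measurable (`[0, c]%classic : set (measurableTypeR R)) by exact: measurable_itv.
transitivity (\int[mu]_(x in `[0%R, c]) (cst 1%E x))%E.
  apply: ae_eq_integral => //.
  - apply/measurable_EFinP.
    apply: (@measurable_funS _ _ _ _ I01) => //.
    apply: subspace_continuous_measurable_fun; first exact: measurable_itv.
    exact: dphi_continuous.
  - apply: (@filterS _ _ (ae_filter_ringOfSetsType mu) _ _ _ dphi_ae) => x hx xc.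
    have xI := sub _ xc.
    by have := hx xI; rewrite patchE mem_set//= => ->.
by rewrite integral_cst// mul1e /= lebesgue_measure_itv/= lte_fin c0 oppr0 adde0.
Qed.

End limit_value.

Lemma error_ratio_limit (uncorrelated :
       \int[lebesgue_measure]_(c in `[0, 1])
          (derive_on `[0, 1] phi c * cond_var P N C c * marginal_density p c)
       - (\int[lebesgue_measure]_(c in `[0, 1]) derive_on `[0, 1] phi c) *
         (\int[lebesgue_measure]_(c in `[0, 1])
            (cond_var P N C c * marginal_density p c)) = 0) :
  exists l : R,
    [/\ error_ratio P phi C N nm np alpha @[alpha --> 0^'+] --> l,
        1 <= l
      & l = 1 -> forall c, c \in `[0, 1] -> phi c = c].
Proof.
have unc := uncorrelated_noise uncorrelated.
exists L; split; first exact: cvg_error_ratio.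
- exact: limit_ge1.
- exact: limit_eq1.
Qed.

End main.

Theorem theorem1 (d : measure_display) (T : measurableType d) (R : realType)
    (P : probability T R) (C N : {RV P >-> R}) (p : R * R -> R)
    (phi phi_inv : R -> R) (n_minus n_plus : R)
    (p_density : is_joint_density P N C p)
    (p_bounded : exists M : R, forall z, p z <= M)
    (N_centered : {ae distribution P C, forall c, cond_exp P N C c = 0})
    (phi_maps : forall c, c \in `[0, 1] -> phi c \in `[0, 1])
    (phi_incr : {in `[0, 1] &, {homo phi : x y / x < y}})
    (phi_diff : forall c, c \in `[0, 1] -> derivable_on `[0, 1] phi c)
    (phi_diff2 : forall c, c \in `[0, 1] ->
       derivable_on `[0, 1] (derive_on `[0, 1] phi) c)
    (phi0 : phi 0 = 0) (phi1 : phi 1 = 1)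
    (phi_invK : {in `[0, 1], cancel phi phi_inv})
    (phi_inv_diff : forall y, y \in `[0, 1] -> derivable_on `[0, 1] phi_inv y)
    (phi_inv_bounded : exists M : R, forall y, y \in `[0, 1] ->
       `|derive_on `[0, 1] phi_inv y| <= M)
    (C_compact : compact (law_support P C))
    (C_min : law_support P C 0) (C_max : law_support P C 1)
    (C_range : law_support P C `<=` `[0, 1])
    (N_compact : compact (law_support P N))
    (n_plus_gt0 : 0 < n_plus) (n_minus_lt0 : n_minus < 0)
    (N_cond_range : forall c, c \in `[0, 1] ->
       smallest_itv_containing
         (closure [set n | cond_density p c n != 0]) n_minus n_plus)
    (mean_var_N : mean_cond_var P N C = 1%E)
    (uncorrelated :
       \int[lebesgue_measure]_(c in `[0, 1])
          (derive_on `[0, 1] phi c * cond_var P N C c * marginal_density p c)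
       - (\int[lebesgue_measure]_(c in `[0, 1]) derive_on `[0, 1] phi c) *
         (\int[lebesgue_measure]_(c in `[0, 1])
            (cond_var P N C c * marginal_density p c)) = 0) :
  exists l : R,
    [/\ error_ratio P phi C N n_minus n_plus alpha @[alpha --> 0^'+] --> l,
        1 <= l
      & l = 1 -> exists a : R, forall c, c \in `[0, 1] -> phi c = a * c].
Proof.
have [l [cl l1 eq]] := error_ratio_limit p_density p_bounded N_centered phi_maps
  phi_incr phi_diff phi_diff2 phi0 phi1 phi_invK phi_inv_diff phi_inv_bounded
  C_range n_plus_gt0 n_minus_lt0 N_cond_range mean_var_N uncorrelated.
(* The boundary values of phi leave 1 as the only possible slope. *)
exists l; split=> // /eq phiE; exists 1 => c c01.
by rewrite mul1r phiE.
Qed.
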